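(* Let $(X,T)$ and $(Y,S)$ be dynamical systems, let $\pi:(X,T)\to(Y,S)$ be a factor map, and let $0<w\le1$. Then \[ h_{\mathrm{top}}^{(w,1-w)}(\pi,T)=h_{\mathrm{top}}^w(\pi,T), \] where the left-hand side is the $(a_1,a_2)$-weighted topological entropy (in the sense of Feng–Huang) for $(a_1,a_2)=(w,1-w)$ and the right-hand side is the $w$-weighted topological entropy of $\pi$.
   Context: A dynamical system $(X,T)$ is a (nonempty) compact metrizable space $X$ together with a continuous map $T:X\to X$. A factor map $\pi:(X,T)\to(Y,S)$ is a continuous surjection $\pi:X\to Y$ with $\pi\circ T=S\circ\pi$. Let $d$ and $d'$ be metrics (compatible with the topologies) on $X$ and $Y$. Definition of $h_{\mathrm{top}}^{(a_1,a_2)}(\pi,T)$ (for reals $a_1>0$, $a_2\ge0$). For $x\in X$, a natural number $n\ge1$ and $\varepsilon>0$, let $B_n^{(a_1,a_2)}(x,\varepsilon)$ be the set of $y\in X$ such that \[ d(T^jx,T^jy)<\varepsilon\quad(0\le j<\lceil a_1n\rceil),\qquad d'(S^j\pi(x),S^j\pi(y))<\varepsilon\quad(0\le j<\lceil(a_1+a_2)n\rceil), \] where $\lceil u\rceil$ is the least integer not less than $u$. For a natural number $N$ and $s\ge0$, let $\Lambda^{(a_1,a_2),s}_{N,\varepsilon}(X)$ be the infimum of $\sum_j\exp(-sn_j)$ over all families $\{B^{(a_1,a_2)}_{n_j}(x_j,\varepsilon)\}_{j=1}^\infty$ with $X=\bigcup_jB^{(a_1,a_2)}_{n_j}(x_j,\varepsilon)$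 and $n_j\ge N$ for all $j\ge1$. This is monotone in $N$; set $\Lambda^{(a_1,a_2),s}_\varepsilon(X)=\lim_{N\to\infty}\Lambda^{(a_1,a_2),s}_{N,\varepsilon}(X)$. There is a unique $h_{\mathrm{top}}^{(a_1,a_2)}(T,\varepsilon)\in[0,\infty]$ such that $\Lambda^{(a_1,a_2),s}_\varepsilon(X)=0$ for $s>h_{\mathrm{top}}^{(a_1,a_2)}(T,\varepsilon)$ and $=\infty$ for $s<h_{\mathrm{top}}^{(a_1,a_2)}(T,\varepsilon)$. It is monotone in $\varepsilon$, and \[ h_{\mathrm{top}}^{(a_1,a_2)}(\pi,T)=\lim_{\varepsilon\to0}h_{\mathrm{top}}^{(a_1,a_2)}(T,\varepsilon). \] Definition of $h_{\mathrm{top}}^w(\pi,T)$ (for $0\le w\le1$). For a natural number $N\ge1$ set \[ d_N(x_1,x_2)=\max_{0\le n<N}d(T^nx_1,T^nx_2),\qquad d'_N(y_1,y_2)=\max_{0\le n<N}d'(S^ny_1,S^ny_2). \] For $\varepsilon>0$ and nonempty $\Omega\subset X$, let $\#(\Omega,N,\varepsilon)$ be the minimum $n\ge1$ such that there exist open subsets $U_1,\dots,U_n$ of $X$ with $\Omega\subset U_1\cup\dots\cup U_n$ and $\mathrm{diam}(U_k,d_N)<\varepsilon$ for all $k$ (diameter with respect to $d_N$); set $\#(\emptyset,N,\varepsilon)=0$. Set \[ \#^w(\pi,N,\varepsilon)=\min\left\{\sum_{k=1}^n\bigl(\#(\pi^{-1}(V_k),N,\varepsilon)\bigr)^w\right\},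 \] the minimum being over all finite open covers $Y=V_1\cup\dots\cup V_n$ with $\mathrm{diam}(V_k,d'_N)<\varepsilon$ for all $k$. This is sub-multiplicative in $N$ and monotone in $\varepsilon$, and \[ h_{\mathrm{top}}^w(\pi,T)=\lim_{\varepsilon\to0}\left(\lim_{N\to\infty}\frac{\log\#^w(\pi,N,\varepsilon)}{N}\right)\in[0,\infty], \] which does not depend on the choice of $d,d'$. *)

(* Defs.v *)
From mathcomp Require Import all_boot all_order all_algebra.
From mathcomp Require Import all_classical all_reals all_analysis.

Set Implicit Arguments.
Unset Strict Implicit.
Unset Printing Implicit Defensive.

Import Order.TTheory GRing.Theory Num.Theory.
Import numFieldNormedType.Exports.

Local Open Scope classical_set_scope.
Local Open Scope ring_scope.

                                                                          
                                                       
Definition dynamical_system (R : realType) (X : metricType R) (T : X -> X) :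
    Prop :=
  [/\ [set: X] !=set0, compact [set: X] & continuous T].

Definition factor_map (R : realType) (X Y : metricType R)
    (T : X -> X) (S : Y -> Y) (pi : X -> Y) : Prop :=
  [/\ continuous pi, range pi = [set: Y] & pi \o T = S \o pi].

Section FengHuang.
Context {R : realType} {X Y : metricType R}.
Variables (T : X -> X) (S : Y -> Y) (pi : X -> Y).
Variables (a1 a2 : R).

Definition wball (n : nat) (x : X) (eps : R) : set X :=
  [set y | (forall j : nat, (j%:Z < Num.ceil (a1 * n%:R))%R ->
              mdist (iter j T x) (iter j T y) < eps) /\
           (forall j : nat, (j%:Z < Num.ceil ((a1 + a2) * n%:R))%R ->
              mdist (iter j S (pi x)) (iter j S (pi y)) < eps)].

                                                                               
                                                                         
Definition LambdaN (N : nat) (eps s : R) : \bar R :=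
  ereal_inf [set z | exists (x : nat -> X) (n : nat -> nat),
    [/\ (forall j, (0 < n j)%N /\ (N <= n j)%N),
        [set: X] = \bigcup_j wball (n j) (x j) eps &
        z = (\sum_(0 <= j <oo) (expR (- s * (n j)%:R))%:E)%E]].

Definition Lambda (eps s : R) : \bar R :=
  lim (LambdaN N eps s @[N --> \oo]).

Definition is_critical_exponent (eps : R) (h : \bar R) : Prop :=
  [/\ (0 <= h)%E,
      (forall s : R, 0 <= s -> (h < s%:E)%E -> Lambda eps s = 0%E) &
      (forall s : R, 0 <= s -> (s%:E < h)%E -> Lambda eps s = +oo%E)].

                                                                           
                                                 
Definition htopFH_eps (eps : R) : \bar R :=
  xget 0%E [set h | is_critical_exponent eps h].

Definition htopFH : \bar R := lim (htopFH_eps eps @[eps --> (0 : R)^'+]).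

End FengHuang.

Definition dynmetric (R : realType) (Z : metricType R) (f : Z -> Z) (N : nat)
    (z1 z2 : Z) : R :=
  \big[Num.max/0]_(n < N) mdist (iter n f z1) (iter n f z2).

                                                                             
                                   
Definition dyndiam (R : realType) (Z : metricType R) (f : Z -> Z) (N : nat)
    (A : set Z) : \bar R :=
  ereal_sup [set (dynmetric f N z1 z2)%:E | z1 in A & z2 in A].

Section Weighted.
Context {R : realType} {X Y : metricType R}.
Variables (T : X -> X) (S : Y -> Y) (pi : X -> Y).
Variable (w : R).

                                                                            
                                                                    
Definition cover_num (Omega : set X) (N : nat) (eps : R) : \bar R :=
  if Omega == set0 then 0%E
  else ereal_inf [set n%:R%:E | n in [set n : nat | (1 <= n)%N /\
    exists U : 'I_n -> set X,
      [/\ (forall k, open (U k)), Omega `<=` \bigcup_k U k &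
          (forall k, (dyndiam T N (U k) < eps%:E)%E)]]].

Definition wcover_num (N : nat) (eps : R) : \bar R :=
  ereal_inf [set z | exists (n : nat) (V : 'I_n -> set Y),
    [/\ (forall k, open (V k)), [set: Y] = \bigcup_k V k,
        (forall k, (dyndiam S N (V k) < eps%:E)%E) &
        z = (\sum_(k < n) cover_num (pi @^-1` V k) N eps `^ w)%E]].

Definition htopw_eps (eps : R) : \bar R :=
  lim ((lne (wcover_num N eps) * (N%:R^-1)%:E)%E @[N --> \oo]).

Definition htopw : \bar R := lim (htopw_eps eps @[eps --> (0 : R)^'+]).

End Weighted.

(* Main.v *)
Require Import Defs.
From mathcomp Require Import all_boot all_order all_algebra.
From mathcomp Require Import all_classical all_reals all_analysis.
From mathcomp Require Import ring lra zify.

Set Implicit Arguments.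
Unset Strict Implicit.
Unset Printing Implicit Defensive.

Import Order.TTheory GRing.Theory Num.Theory.
Import numFieldNormedType.Exports.

Local Open Scope classical_set_scope.
Local Open Scope ring_scope.

(** Both inequalities are proved combinatorially, without invariant measures.

    Upper bound.  Code a point by the blocks, of a fixed length N, of a nearly
    optimal cover; let t be the size of the fibre over a block and Z the sum of
    the t^w.  A point is caught by a weighted ball of M blocks which only records
    its code in Y up to time M and its code in X up to time wM.  Since the
    Birkhoff averages of log t are bounded, they cannot decrease by a definite
    amount at every step of the chain M, M/w, M/w^2, ..., so every point has a
    scale at which the balls it needs number about Z^M.

    Lower bound.  A finite cover by weighted balls with sum exp(-s n_j) <= 1 is
    iterated along the orbit, cutting the time axis into tiles of lengths n_j;
    there are at most exp(s m) such codes.  Over a point of Y, a code leaves the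
    fibre undetermined only on the last (1 - w) part of each tile.  If the local
    complexity of the fibre were stationary, the free part would contribute
    (1 - w) of the total complexity and interpolation would give h <= s.  An
    energy argument over many lacunary scales supplies, for each point, a scale
    at which it is stationary.  Multiplicity of covers of Y is controlled by a
    second pigeonhole over radii, choosing for each point a radius at which
    shrinking the tube around it does not change its complexity. *)

(** * Averages over blocks and tilings *)

Section BlockAverages.
Context {R : realType}.
Implicit Types (f g : nat -> R) (W m n : nat) (C : R).

(** Let the tube of y be followed by n codes, and let P be the sum of the local log complexities
    along y up to time m. At a stationary scale its cover number t satisfies t <= n exp((1-w)P) up
    to small factors, so t^w <= n^w (exp(wP))^(1-w). Over separated points the n add up to at most
    about exp(sm), as a code is followed in the tube of only one of them, and the exp(wP) add up to
    at most about exp(hm), being products of weights of a near-optimal cover. Interpolation gives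
    exp((ws + (1-w)h)m), while every small cover of Y weighs at least about exp(hm): hence wh <= ws.
    Cancelling (1-w)h requires h to be finite, which takes a separate crude estimate. The obstacle
    is a gap of radii: the points are separated at radius eta, only tubes of a smaller radius lam
    around them are controlled, and a cover of Y needs radius eta. This forces the pigeonhole over
    radii, each radius coming from a Lebesgue number for a cover at the previous one. The upper
    bound has no such loss and holds at each fixed eps. *)

Definition psum f n : R := \sum_(0 <= b < n) f b.

Definition block_avg W f (b : nat) : R :=
  (\sum_(0 <= i < W) f (b %/ W * W + i)%N) / W%:R.

Lemma psumD f m n :
  psum f (m + n) = psum f m + \sum_(0 <= b < n) f (m + b)%N.
Proof.
rewrite /psum (big_cat_nat (leq0n m) (leq_addr n m)) /=; congr (_ + _).
by rewrite -{1}[m]add0n big_addn addKn; apply: eq_bigr => i _; rewrite addnC.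
Qed.

Lemma psum_blocks f W q :
  psum f (q * W) = \sum_(0 <= k < q) \sum_(0 <= i < W) f (k * W + i)%N.
Proof.
elim: q => [|q IHq]; first by rewrite mul0n /psum !big_geq.
by rewrite mulSn addnC psumD IHq big_nat_recr.
Qed.

Lemma block_avg_block W f k i : (i < W)%N ->
  block_avg W f (k * W + i) = (\sum_(0 <= j < W) f (k * W + j)%N) / W%:R.
Proof.
move=> iW; have W0 : (0 < W)%N by apply: leq_ltn_trans iW.
by rewrite /block_avg divnMDl// divn_small// addn0.
Qed.

Lemma sum_le_const n f C : (forall b, f b <= C) ->
  \sum_(0 <= b < n) f b <= n%:R * C.
Proof.
move=> fC; rewrite (@le_trans _ _ (\sum_(0 <= b < n) C)) ?ler_sum//.
by rewrite sumr_const_nat subn0 mulr_natl.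
Qed.

Lemma block_avg_ge0 W f : (forall b, 0 <= f b) -> forall b, 0 <= block_avg W f b.
Proof. by move=> f0 b; rewrite divr_ge0// sumr_ge0. Qed.

Lemma block_avg_le W f C : (0 < W)%N -> (forall b, f b <= C) ->
  forall b, block_avg W f b <= C.
Proof.
move=> W0 fC b; rewrite ler_pdivrMr ?ltr0n// mulrC.
by apply: sum_le_const => i; exact: fC.
Qed.

Lemma psum_block_avg W f q : (0 < W)%N ->
  psum (block_avg W f) (q * W) = psum f (q * W).
Proof.
move=> W0; rewrite !psum_blocks; apply: eq_bigr => k _.
transitivity (\sum_(0 <= i < W) ((\sum_(0 <= j < W) f (k * W + j)%N) / W%:R)); last first.
  by rewrite sumr_const_nat subn0 -[_ *+ W]mulr_natr mulfVK// pnatr_eq0 -lt0n.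
by apply: eq_big_nat => i /andP[_ iW]; rewrite block_avg_block.
Qed.

Lemma sum_norm_le n f C : (forall b, `|f b| <= C) ->
  `|\sum_(0 <= b < n) f b| <= n%:R * C.
Proof.
by move=> fC; apply: le_trans (ler_norm_sum _ _ _) _; apply: sum_le_const.
Qed.

Lemma psum_block_avg_dist W f C n : (0 < W)%N -> (forall b, 0 <= f b <= C) ->
  `|psum f n - psum (block_avg W f) n| <= W%:R * C.
Proof.
move=> W0 fC.
have C0 : 0 <= C by have /andP[] := fC 0%N; exact: le_trans.
rewrite (divn_eq n W) !psumD psum_block_avg// opprD addrACA subrr add0r -sumrB.
apply: (@le_trans _ _ ((n %% W)%N%:R * C)); last first.
  by rewrite ler_wpM2r// ler_nat ltnW// ltn_mod.
apply: sum_norm_le => b /=.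
have /andP[f0 f1] := fC (n %/ W * W + b)%N.
have g0 := @block_avg_ge0 W f (fun b => proj1 (andP (fC b))) (n %/ W * W + b)%N.
have g1 := block_avg_le W0 (fun b => proj2 (andP (fC b))) (n %/ W * W + b)%N.
by rewrite ler_norml; lra.
Qed.

(** On a complete block averaging is the orthogonal projection onto constants, so Pythagoras gives
    equality. Only the incomplete last block loses: fewer than [W] terms [2 y^2 - 2 x y], each at
    most [2 C^2]. *)
Lemma block_avg_energy W f C m : (0 < W)%N -> (forall b, 0 <= f b <= C) ->
  psum (fun b => (f b - block_avg W f b) ^+ 2) m <=
  psum (fun b => f b ^+ 2) m - psum (fun b => block_avg W f b ^+ 2) m
  + W%:R * (2 * C ^+ 2).
Proof.
move=> W0 fC.
have C0 : 0 <= C by have /andP[] := fC 0%N; exact: le_trans.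
have WR : W%:R != 0 :> R by rewrite pnatr_eq0 -lt0n.
have blocks q : psum (fun b => (f b - block_avg W f b) ^+ 2) (q * W) =
  psum (fun b => f b ^+ 2) (q * W) - psum (fun b => block_avg W f b ^+ 2) (q * W).
  rewrite !psum_blocks -sumrB; apply: eq_bigr => k _.
  set a := (\sum_(0 <= j < W) f (k * W + j)%N) / W%:R.
  have sa : \sum_(0 <= j < W) f (k * W + j)%N = W%:R * a by rewrite mulrC mulfVK.
  rewrite (@eq_big_nat _ _ _ _ _ _
    (fun i => f (k * W + i)%N ^+ 2 - (2 * a) * f (k * W + i)%N + a ^+ 2)); last first.
    by move=> i /andP[_ iW]; rewrite block_avg_block// -/a; ring.
  rewrite [X in _ = _ - X](@eq_big_nat _ _ _ _ _ _ (fun=> a ^+ 2)); last first.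
    by move=> i /andP[_ iW]; rewrite block_avg_block.
  rewrite big_split sumrB -mulr_sumr sa sumr_const_nat subn0 -mulr_natl /=; ring.
rewrite (divn_eq m W) !psumD blocks.
set q := (m %/ W)%N; set r := (m %% W)%N.
set A := psum _ _; set B := psum _ _.
have : \sum_(0 <= b < r) ((f (q * W + b)%N - block_avg W f (q * W + b)%N) ^+ 2
   - f (q * W + b)%N ^+ 2 + block_avg W f (q * W + b)%N ^+ 2) <= W%:R * (2 * C ^+ 2).
  apply: (@le_trans _ _ (r%:R * (2 * C ^+ 2))); last first.
    by rewrite ler_wpM2r ?ler_nat ?(ltnW (ltn_pmod _ _))// mulr_ge0// sqr_ge0.
  apply: sum_le_const => b.
  have /andP[f0 f1] := fC (q * W + b)%N.
  have g0 := @block_avg_ge0 W f (fun b => proj1 (andP (fC b))) (q * W + b)%N.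
  have g1 := block_avg_le W0 (fun b => proj2 (andP (fC b))) (q * W + b)%N.
  move: (f _) (block_avg _ _ _) f0 f1 g0 g1 => x y x0 x1 y0 y1.
  rewrite -(subr_ge0 _ (2 * _)); have -> : 2 * C ^+ 2 - ((x - y) ^+ 2 - x ^+ 2 + y ^+ 2)
     = 2 * (C - y) * (C + y) + 2 * x * y by ring.
  by rewrite addr_ge0// mulr_ge0// ?mulr_ge0// ?subr_ge0// addr_ge0.
rewrite big_split sumrB /=; lra.
Qed.

(** Each window averages the previous average rather than [f] itself, so the energies telescope with
    no divisibility between windows. *)
Definition coarsen (Ws : nat -> nat) f :=
  fix g k := if k is k'.+1 then block_avg (Ws k') (g k') else f.

Lemma coarsen_bound Ws f C k : (forall k, 0 < Ws k)%N ->
  (forall b, 0 <= f b <= C) -> forall b, 0 <= coarsen Ws f k b <= C.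
Proof.
move=> W0 fC; elim: k => [|k IHk] b //=.
by rewrite block_avg_ge0 ?block_avg_le// => c; have /andP[] := IHk c.
Qed.

Lemma coarsen_psum_dist Ws f C k n : (forall k, 0 < Ws k)%N ->
  (forall b, 0 <= f b <= C) ->
  `|psum f n - psum (coarsen Ws f k) n| <= (\sum_(0 <= i < k) Ws i)%N%:R * C.
Proof.
move=> W0 fC; elim: k => [|k IHk] /=; first by rewrite subrr normr0 big_geq// mul0r.
rewrite big_nat_recr//= natrD mulrDl.
rewrite -[_ - _](subrKA (psum (coarsen Ws f k) n)).
apply: le_trans (ler_normD _ _) _; rewrite lerD//.
by apply: psum_block_avg_dist => //; exact: coarsen_bound.
Qed.

Lemma coarsen_energy Ws f C K m : (forall k, 0 < Ws k)%N ->
  (forall b, 0 <= f b <= C) ->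
  \sum_(0 <= k < K) psum (fun b => (coarsen Ws f k b - coarsen Ws f k.+1 b) ^+ 2) m
  <= m%:R * C ^+ 2 + (\sum_(0 <= i < K) Ws i)%N%:R * (2 * C ^+ 2).
Proof.
move=> W0 fC.
have : \sum_(0 <= k < K) psum (fun b => (coarsen Ws f k b - coarsen Ws f k.+1 b) ^+ 2) m
  <= psum (fun b => f b ^+ 2) m - psum (fun b => coarsen Ws f K b ^+ 2) m
     + (\sum_(0 <= i < K) Ws i)%N%:R * (2 * C ^+ 2).
  elim: K => [|K IHK]; first by rewrite !big_geq//= subrr mul0r addr0.
  rewrite !big_nat_recr//= natrD mulrDl.
  have := block_avg_energy m (W0 K) (coarsen_bound K W0 fC); lra.
have : psum (fun b => f b ^+ 2) m <= m%:R * C ^+ 2.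
  apply: sum_le_const => b; have /andP[f0 f1] := fC b.
  by rewrite ler_pXn2r// nnegrE// (le_trans f0).
have : 0 <= psum (fun b => coarsen Ws f K b ^+ 2) m.
  by apply: sumr_ge0 => b _; exact: sqr_ge0.
lra.
Qed.

(* Pigeonhole on the energies, then |z| <= delta + z^2 / delta. *)
Lemma coarsen_stable_scale Ws f C K m delta : (forall k, 0 < Ws k)%N ->
  (forall b, 0 <= f b <= C) -> 0 < delta -> (0 < K)%N ->
  C ^+ 2 <= K%:R * delta ^+ 2 ->
  exists2 k, (k < K)%N &
   psum (fun b => `|coarsen Ws f k b - coarsen Ws f k.+1 b|) m <=
   2 * delta * m%:R + (\sum_(0 <= i < K) Ws i)%N%:R * (2 * delta).
Proof.
move=> W0 fC d0 K0 CK.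
set A := (\sum_(0 <= i < K) Ws i)%N.
pose E k := psum (fun b => (coarsen Ws f k b - coarsen Ws f k.+1 b) ^+ 2) m.
have KR : 0 < K%:R :> R by rewrite ltr0n.
have [k kK Ek] : exists2 k, (k < K)%N & E k <= delta ^+ 2 * (m%:R + 2 * A%:R).
  apply: contrapT => noK.
  have : K%:R * (delta ^+ 2 * (m%:R + 2 * A%:R)) < \sum_(0 <= k < K) E k.
    rewrite mulr_natl -[K in X in X < _]subn0 -sumr_const_nat.
    apply: ltr_sum_nat => // k /andP[_ kK]; rewrite ltNge; apply/negP => Ek.
    by apply: noK; exists k.
  rewrite ltNge => /negP; apply; apply: le_trans (coarsen_energy K m W0 fC) _.
  rewrite -/A; have -> : m%:R * C ^+ 2 + A%:R * (2 * C ^+ 2) = (m%:R + 2 * A%:R) * C ^+ 2 by ring.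
  rewrite (mulrA K%:R) [leRHS]mulrC ler_wpM2l// addr_ge0// mulr_ge0//.
exists k => //.
have : psum (fun b => `|coarsen Ws f k b - coarsen Ws f k.+1 b|) m <=
   m%:R * delta + E k / delta.
  rewrite /E /psum mulr_suml mulr_natl -[m in _ *+ m]subn0 -sumr_const_nat -big_split /=.
  apply: ler_sum => b _; set z := _ - _; rewrite -real_normK ?num_real//.
  have [zd|dz] := lerP `|z| delta; first by rewrite ler_wpDr// divr_ge0// ?sqr_ge0 ?ltW.
  rewrite ler_wpDl ?(ltW d0)// ler_pdivlMr// expr2 ler_wpM2l// ltW//.
have : E k / delta <= delta * (m%:R + 2 * A%:R).
  by rewrite ler_pdivrMr//; apply: le_trans Ek _; rewrite expr2; lra.
lra.
Qed.

End BlockAverages.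

(** * Tilings and the sums over their free parts *)

Section Tilings.
Context {R : realType}.
Implicit Types (f g : nat -> R) (s : seq (nat * nat)) (a m n p q N W : nat) (C A w : R).

(* A tiling is a list of tiles (p, q) placed end to end; the free part of a tile
   [a, a + p) is [a + q, a + p). *)
Fixpoint free_sum f a s : R :=
  if s is t :: s' then
    \sum_(a + t.2 <= b < a + t.1) f b + free_sum f (a + t.1) s'
  else 0.

Definition tiling_length s := (\sum_(t <- s) t.1)%N.

Definition tile_at_scale w N pm (t : nat * nat) :=
  [/\ (N <= t.1 <= pm)%N, (t.2 <= t.1)%N & t.1%:R - t.2%:R <= (1 - w) * t.1%:R + 1 :> R].

Lemma psum_ge0 f n : (forall b, 0 <= f b) -> 0 <= psum f n.
Proof. by move=> f0; exact: sumr_ge0. Qed.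

Lemma sum_psumB f m n : (m <= n)%N ->
  \sum_(m <= b < n) f b = psum f n - psum f m.
Proof.
by move=> mn; rewrite /psum (big_cat_nat (leq0n m) mn) /= addrC addrK.
Qed.

Lemma le_psum f m n : (forall b, 0 <= f b) -> (m <= n)%N -> psum f m <= psum f n.
Proof. by move=> f0 mn; rewrite -subr_ge0 -sum_psumB// sumr_ge0. Qed.

Lemma psum_le_add f C m n : (forall b, 0 <= f b <= C) -> psum f (m + n) <= psum f m + n%:R * C.
Proof.
move=> fC; rewrite psumD lerD2l; apply: sum_le_const => b.
by have /andP[] := fC (m + b)%N.
Qed.

Lemma psum_le_addW f C m n p : (forall b, 0 <= f b <= C) -> (n <= m + p)%N ->
  psum f n <= psum f m + p%:R * C.
Proof.
move=> fC nmp; apply: le_trans (psum_le_add m p fC).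
by apply: le_psum => // b; have /andP[] := fC b.
Qed.

Lemma free_sum_close f g A a s : (forall n, `|psum f n - psum g n| <= A) ->
  (forall t, t \in s -> (t.2 <= t.1)%N) ->
  free_sum f a s <= free_sum g a s + 2 * A * (size s)%:R.
Proof.
move=> fgA; elim: s a => [|t s IHs] a /= ts; first by rewrite mulr0 addr0.
have t21 : (a + t.2 <= a + t.1)%N by rewrite leq_add2l ts// mem_head.
have := IHs (a + t.1)%N (fun u us => ts u (@mem_behead _ (t :: s) u us)).
rewrite !sum_psumB// -addn1 natrD.
have := fgA (a + t.2)%N; have := fgA (a + t.1)%N; rewrite !ler_norml; lra.
Qed.

Lemma free_sum_le_abs f g a s : (forall t, t \in s -> (t.2 <= t.1)%N) ->
  free_sum f a s <= free_sum g a s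
    + \sum_(a <= b < a + tiling_length s) `|f b - g b|.
Proof.
elim: s a => [|t s IHs] a ts /=.
  by rewrite add0r sumr_ge0.
have t21 : (t.2 <= t.1)%N by rewrite ts// mem_head.
have := IHs (a + t.1)%N (fun u us => ts u (@mem_behead _ (t :: s) u us)).
rewrite /tiling_length big_cons addnA.
rewrite [in X in _ -> _ <= _ + X](big_cat_nat (leq_addr t.1 a)) ?leq_addr//=.
set L := (a + t.1 + _)%N; move=> IH.
have : \sum_(a + t.2 <= b < a + t.1) f b <= \sum_(a + t.2 <= b < a + t.1) g b
   + \sum_(a <= b < a + t.1) `|f b - g b|.
  rewrite (big_cat_nat (leq_addr t.2 a)) ?leq_add2l//=.
  rewrite addrCA -big_split /= ler_wpDl ?sumr_ge0// ler_sum// => b _.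
  by have := ler_norm (f b - g b); lra.
lra.
Qed.

(** Block averages are constant on a block, so a tile inside one block has a free share of [1 - w],
    up to the rounding unit of [tile_at_scale], which costs [C]. A tile crossing a block boundary is
    charged [C * pm]; crossings are counted by the increments of [a %/ W]. *)
Lemma free_sum_block_avg W f C w pm a s : (0 < W)%N -> 0 <= w <= 1 ->
  (forall b, 0 <= f b <= C) ->
  (forall t, t \in s -> tile_at_scale w 0 pm t) ->
  free_sum (block_avg W f) a s <=
  (1 - w) * \sum_(a <= b < a + tiling_length s) block_avg W f b
  + C * (size s)%:R
  + C * pm%:R * (((a + tiling_length s) %/ W)%:R - (a %/ W)%:R).
Proof.
move=> W0 /andP[w0 w1] fC ts.
have C0 : 0 <= C by have /andP[] := fC 0%N; exact: le_trans.
have g0 := @block_avg_ge0 R W f (fun b => proj1 (andP (fC b))).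
have g1 := block_avg_le W0 (fun b => proj2 (andP (fC b))).
elim: s a ts => [|t s IHs] a ts /=.
  by rewrite /tiling_length big_nil addn0 subrr big_geq// !mulr0 !addr0.
have [/andP[_ t1] t21 tw] := ts t (mem_head _ _).
have := IHs (a + t.1)%N (fun u us => ts u (@mem_behead _ (t :: s) u us)).
rewrite /tiling_length big_cons addnA.
rewrite [in X in _ -> _ <= X](big_cat_nat (leq_addr t.1 a)) ?leq_addr//=.
rewrite -[in (size s).+1%:R]addn1 natrD.
set L := (a + t.1 + _)%N; move=> IH.
suff : \sum_(a + t.2 <= b < a + t.1) block_avg W f b <=
   (1 - w) * \sum_(a <= b < a + t.1) block_avg W f b + C
   + C * pm%:R * (((a + t.1) %/ W)%:R - (a %/ W)%:R) by lra.
have [eqW|neW] := eqVneq ((a + t.1) %/ W)%N (a %/ W)%N.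
  have cst b : (a <= b < a + t.1)%N -> block_avg W f b = block_avg W f a.
    move=> /andP[ab ba]; rewrite /block_avg.
    suff -> : (b %/ W = a %/ W)%N by [].
    by apply/eqP; rewrite eqn_leq (leq_div2r W ab) andbT -eqW leq_div2r// ltnW.
  rewrite (@eq_big_nat _ _ _ (a + t.2)%N _ _ (fun=> block_avg W f a)); last first.
    by move=> b /andP[ab ba]; rewrite cst// ba (leq_trans _ ab)// leq_addr.
  rewrite (@eq_big_nat _ _ _ a _ _ (fun=> block_avg W f a)); last by move=> b; exact: cst.
  rewrite !sumr_const_nat subnDl addKn eqW subrr mulr0 addr0.
  rewrite -[leLHS]mulr_natl -(mulr_natl _ t.1) natrB//.
  have := ler_wpM2r (g0 a) tw; have := g1 a; lra.
have : 1 <= ((a + t.1) %/ W)%:R - (a %/ W)%:R :> R.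
  rewrite lerBrDr -[1]/(1%:R) -natrD ler_nat add1n ltn_neqAle eq_sym neW.
  by rewrite leq_div2r// leq_addr.
have Cp : 0 <= C * pm%:R by rewrite mulr_ge0.
move=> /(ler_wpM2l Cp); rewrite mulr1.
have : 0 <= (1 - w) * \sum_(a <= b < a + t.1) block_avg W f b.
  by rewrite mulr_ge0 ?subr_ge0// sumr_ge0.
have : \sum_(a + t.2 <= b < a + t.1) block_avg W f b <= C * pm%:R.
  rewrite -{1}[(a + t.2)%N]add0n big_addn; apply: le_trans (sum_le_const _ (C := C) _) _.
    by move=> b; exact: g1.
  by rewrite mulrC ler_wpM2l// ler_nat subnDl (leq_trans (leq_subr _ _)).
lra.
Qed.

Lemma tiling_length_size s N : (forall t, t \in s -> (N <= t.1)%N) ->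
  (size s * N <= tiling_length s)%N.
Proof.
elim: s => [|t s IHs] ts; first by rewrite mul0n.
rewrite /tiling_length big_cons mulSn leq_add//.
  by rewrite ts// mem_head.
by apply: IHs => u us; apply: ts; rewrite inE us orbT.
Qed.

(** Replacing [f] by its [k]-th average costs a bounded amount per tile, negligible because tiles
    are long compared with the earlier windows. Passing to the next average costs an l1 distance,
    kept in the bound for the energy argument. The last average is nearly constant along tiles
    because [Ws k] is long compared with them. *)
Lemma free_sum_scale Ws f C w k m N pm delta s :
  (forall k, 0 < Ws k)%N -> (forall b, 0 <= f b <= C) -> 0 <= w <= 1 -> 0 < delta ->
  2 * ((\sum_(0 <= i < k) Ws i)%N%:R * C) + C <= delta * N%:R ->
  C * pm%:R <= delta * (Ws k)%:R ->
  (forall t, t \in s -> tile_at_scale w N pm t) ->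
  (tiling_length s <= m + pm)%N ->
  free_sum f 0 s <= (1 - w) * psum f m
    + psum (fun b => `|coarsen Ws f k b - coarsen Ws f k.+1 b|) m
    + 2 * delta * m%:R
    + (2 * (pm%:R * C) + 2 * delta * pm%:R
       + (\sum_(0 <= i < k.+1) Ws i)%N%:R * C).
Proof.
move=> W0 fC w01 d0 NC Wpm ts sm.
have /andP[w0 w1] := w01.
have C0 : 0 <= C by have /andP[] := fC 0%N; exact: le_trans.
have t21 t : t \in s -> (t.2 <= t.1)%N by case/ts.
set A := (\sum_(0 <= i < k) Ws i)%N in NC *.
set L := tiling_length s in sm *.
have := @free_sum_close f (coarsen Ws f k) (A%:R * C) 0 s
  (fun n => coarsen_psum_dist k n W0 fC) t21.
have := @free_sum_le_abs (coarsen Ws f k) (coarsen Ws f k.+1) 0 s t21.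
have := @free_sum_block_avg (Ws k) (coarsen Ws f k) C w pm 0 s (W0 k) w01
  (coarsen_bound k W0 fC).
rewrite -/L add0n div0n subr0 -/(psum _ _) -/(psum _ _).
rewrite -/(coarsen Ws f k.+1) => /(_ _)/wrap[].
  by move=> t /ts[/andP[_ ?] ? ?]; split => //; rewrite leq0n.
set S := (size s)%:R; set D := psum (fun b => `|_|) L.
move=> h1 h2 h3.
have sizeN : S * N%:R <= L%:R.
  by rewrite -natrM ler_nat; apply: tiling_length_size => t /ts[/andP[]].
have LR : L%:R <= m%:R + pm%:R :> R by rewrite -natrD ler_nat.
have h4 : 2 * (A%:R * C) * S + C * S <= delta * (m%:R + pm%:R).
  rewrite -mulrDl; apply: (@le_trans _ _ (delta * N%:R * S)).
    by rewrite ler_wpM2r.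
  by rewrite -mulrA ler_wpM2l ?(ltW d0)// mulrC (le_trans sizeN).
have h5 : C * pm%:R * (L %/ Ws k)%:R <= delta * (m%:R + pm%:R).
  apply: (@le_trans _ _ (delta * (Ws k)%:R * (L %/ Ws k)%:R)).
    by rewrite ler_wpM2r.
  rewrite -mulrA ler_wpM2l ?(ltW d0)// (le_trans _ LR)// -natrM ler_nat mulnC.
  exact: leq_trunc_div.
have h6 : psum (coarsen Ws f k.+1) L <= psum f m + pm%:R * C
     + (\sum_(0 <= i < k.+1) Ws i)%N%:R * C.
  have := coarsen_psum_dist k.+1 L W0 fC; rewrite ler_norml.
  have := psum_le_addW fC sm => hh; rewrite -/L in hh *; move/andP=>[hh1 hh2]; lra.
have h7 : D <= psum (fun b => `|coarsen Ws f k b - coarsen Ws f k.+1 b|) m + pm%:R * C.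
  apply: psum_le_addW => // b; rewrite normr_ge0 andTb.
  have := coarsen_bound k W0 fC b; have := coarsen_bound k.+1 W0 fC b.
  by rewrite ler_norml => /andP[? ?] /andP[? ?]; apply/andP; split; lra.
have h8 : 0 <= pm%:R * C + (\sum_(0 <= i < k.+1) Ws i)%N%:R * C by rewrite addr_ge0// mulr_ge0.
have h9 : (1 - w) * psum (coarsen Ws f k.+1) L <= (1 - w) * psum f m + (pm%:R * C
     + (\sum_(0 <= i < k.+1) Ws i)%N%:R * C).
  apply: (@le_trans _ _ ((1 - w) * (psum f m + (pm%:R * C
     + (\sum_(0 <= i < k.+1) Ws i)%N%:R * C)))).
    by rewrite ler_wpM2l ?subr_ge0// addrA.
  by rewrite mulrDr lerD2l ler_piMl//; lra.
lra.
Qed.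

(* With the K scales chosen lacunary enough, every bounded sequence has a scale
   at which it looks stationary to all tilings of that scale. *)
Lemma exists_stationary_scale (Ws Ns pms : nat -> nat) C w K delta :
  (forall k, 0 < Ws k)%N -> 0 <= C -> 0 <= w <= 1 -> 0 < delta -> (0 < K)%N ->
  C ^+ 2 <= K%:R * delta ^+ 2 ->
  (forall k, 2 * ((\sum_(0 <= i < k) Ws i)%N%:R * C) + C <= delta * (Ns k)%:R) ->
  (forall k, C * (pms k)%:R <= delta * (Ws k)%:R) ->
  exists D : R, forall f m, (forall b, 0 <= f b <= C) ->
  exists2 k, (k < K)%N & forall s,
    (forall t, t \in s -> tile_at_scale w (Ns k) (pms k) t) ->
    (tiling_length s <= m + pms k)%N ->
    free_sum f 0 s <= (1 - w) * psum f m + 4 * delta * m%:R + D.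
Proof.
move=> W0 C0 w01 d0 K0 CK NC Wpm.
pose E k : R := 2 * ((pms k)%:R * C) + 2 * delta * (pms k)%:R
       + (\sum_(0 <= i < k.+1) Ws i)%N%:R * C.
have E0 k : 0 <= E k.
  by rewrite !addr_ge0// ?mulr_ge0// ?mulr_ge0// ltW.
(* The errors of all [K] scales are added, so that the constant does not depend on the scale which
   [f] and [m] select. *)
exists (\sum_(0 <= k < K) E k + (\sum_(0 <= i < K) Ws i)%N%:R * (2 * delta)).
move=> f m fC.
have [k kK Dk] := coarsen_stable_scale m W0 fC d0 K0 CK.
exists k => // s ts sm.
have := free_sum_scale W0 fC w01 d0 (NC k) (Wpm k) ts sm.
have : E k <= \sum_(0 <= k < K) E k.
  by rewrite big_mkord (bigD1 (Ordinal kK)) //= lerDl sumr_ge0.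
rewrite /E; lra.
Qed.

End Tilings.

(** * Codes *)

Section Codes.
Context {R : realType} {I : eqType}.
Variables (r : seq I) (p : I -> nat).
Implicit Types (J : seq I) (j : I) (n m : nat).

(** [n] is fuel. Truncated subtraction ends a code at the first tile that reaches time [m], so the
    overshoot is less than one tile. *)
Fixpoint codes n m : seq (seq I) :=
  if m == 0%N then [:: [::]]
  else if n is n'.+1 then [seq j :: J | j <- r, J <- codes n' (m - p j)]
  else [::].

Definition code_length J := (\sum_(j <- J) p j)%N.

(** A Kraft inequality: extending a code by all possible tiles multiplies its weight by a total of
    at most 1. *)
Lemma codes_sum_le1 (u : I -> R) n m : (forall j, 0 <= u j) ->
  \sum_(j <- r) u j <= 1 ->
  \sum_(J <- codes n m) \prod_(j <- J) u j <= 1.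
Proof.
move=> u0 u1; elim: n m => [|n IHn] m /=; case: ifP => _;
  rewrite ?big_seq1 ?big_nil //.
rewrite big_allpairs_dep /=; apply: le_trans u1; apply: ler_sum => j _.
under eq_bigr do rewrite big_cons.
by rewrite -mulr_sumr ler_piMr.
Qed.

Lemma mem_codes n m J : J \in codes n m ->
  {subset J <= r} /\ (m <= code_length J)%N.
Proof.
elim: n m J => [|n IHn] m J /=; case: eqP => [->|m0]; rewrite ?inE => //.
- by move=> /eqP->; rewrite /code_length big_nil.
- by move=> /eqP->; rewrite /code_length big_nil.
move=> /allpairsPdep[j [J' [jr /IHn[J'r mJ'] ->]]]; split.
  by move=> i; rewrite inE => /orP[/eqP->|/J'r].
by rewrite /code_length big_cons -leq_subLR.
Qed.

Lemma code_length_le n m J pm : (forall j, j \in r -> (p j <= pm)%N) ->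
  J \in codes n m -> (code_length J <= m + pm)%N.
Proof.
move=> ppm; elim: n m J => [|n IHn] m J /=; case: eqP => [->|/eqP m0]; rewrite ?inE => //.
- by move=> /eqP->; rewrite /code_length big_nil.
- by move=> /eqP->; rewrite /code_length big_nil.
move=> /allpairsPdep[j [J' [jr J'n ->]]].
rewrite /code_length big_cons; have := IHn _ _ J'n; have := ppm j jr.
move: J'n; rewrite /code_length; case: (leqP m (p j)) => [mp|pm' _]; last lia.
have /eqP -> : (m - p j)%N == 0%N by rewrite subn_eq0.
case: n {IHn} => [|n] /=; rewrite inE => /eqP ->; rewrite big_nil; lia.
Qed.

(** A code has length at most [m + pm], hence weight at least [expR (- c * (m + pm))], and by
    [codes_sum_le1] the weights sum to at most 1. *)
Lemma size_codes_le (c : R) n m pm : 0 <= c ->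
  (forall j, j \in r -> (p j <= pm)%N) ->
  \sum_(j <- r) expR (- c * (p j)%:R) <= 1 ->
  (size (codes n m))%:R <= expR (c * (m + pm)%:R).
Proof.
move=> c0 ppm /(@codes_sum_le1 (fun j => expR (- c * (p j)%:R)) n m).
move=> /(_ (fun=> expR_ge0 _)).
have expJ J : \prod_(j <- J) expR (- c * (p j)%:R) = expR (- c * (code_length J)%:R).
  rewrite /code_length; elim: J => [|j J IHJ]; first by rewrite !big_nil mulr0 expR0.
  by rewrite !big_cons IHJ -expRD natrD mulrDr.
have : \sum_(J <- codes n m) expR (- c * (m + pm)%:R) <=
   \sum_(J <- codes n m) \prod_(j <- J) expR (- c * (p j)%:R).
  rewrite big_seq [leRHS]big_seq; apply: ler_sum => J Jc.
  rewrite expJ ler_expR !mulNr lerN2 ler_wpM2l// ler_nat.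
  exact: code_length_le Jc.
move=> /le_trans h /h; rewrite big_const_seq count_predT iter_addr_0.
by rewrite mulNr expRN -[_ *+ _]mulr_natl ler_pdivrMr ?expR_gt0// mul1r.
Qed.

Variables (Z : Type) (f : Z -> Z) (B : I -> set Z).

Fixpoint follows J z : Prop :=
  if J is j :: J' then B j z /\ follows J' (iter (p j) f z) else True.

Lemma codes_cover : (forall j, j \in r -> (0 < p j)%N) ->
  (forall z, exists2 j, j \in r & B j z) ->
  forall n m z, (m <= n)%N -> exists2 J, J \in codes n m & follows J z.
Proof.
move=> p0 rB; elim=> [|n IHn] m z mn /=.
  by exists [::]; rewrite //; case: eqP mn => //; lia.
case: eqP => [_|/eqP m0]; first by exists [::]; rewrite ?inE.
have [j jr Bjz] := rB z.
have [|J Jn Jz] := IHn (m - p j)%N (iter (p j) f z).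
  by have := p0 j jr; lia.
exists (j :: J) => //; apply/allpairsPdep; exists j, J; split => //.
Qed.

End Codes.

(** * Chains of scales and Fekete's lemma *)

Section Chain.
Context {R : realType}.
Variable w : R.
Hypothesis w01 : 0 < w <= 1.

Definition next_level (M : nat) : nat := Num.truncn (M%:R / w).

Lemma next_levelP M :
  [/\ (M <= next_level M)%N, w * (next_level M)%:R <= M%:R &
      M%:R - 1 < w * (next_level M)%:R].
Proof.
have /andP[w0 w1] := w01.
have Mw : 0 <= M%:R / w by rewrite divr_ge0// ltW.
have /andP[le1 lt1] := truncn_itv Mw.
rewrite -/(next_level M) in le1 lt1.
split.
- rewrite -ltnS -(ltr_nat R); apply: le_lt_trans lt1.
  by rewrite ler_pdivlMr// ler_piMr.
- by rewrite mulrC -ler_pdivlMr.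
- move: lt1; rewrite ltr_pdivrMr// -natr1 mulrDl mul1r mulrC; lra.
Qed.

Lemma iter_next_level_ge i M : (M <= iter i next_level M)%N.
Proof.
elim: i => //= i IHi; apply: leq_trans IHi _.
by have [] := next_levelP (iter i next_level M).
Qed.

(* The averages along the chain are bounded, hence cannot drop by delta at each step. *)
Lemma exists_chain_step (a : nat -> R) C delta r M0 : (forall n, 0 <= a n <= C) ->
  C < r%:R * delta ->
  exists2 i, (i < r)%N &
    a (iter i next_level M0) - delta <= a (iter i.+1 next_level M0).
Proof.
move=> aC Cr; apply: contrapT => noi.
have : a (iter r next_level M0) <= a M0 - r%:R * delta.
  have : (r <= r)%N by [].
  elim: {1 3 4}r => [|i IHi] ir; first by rewrite mul0r subr0.
  have := IHi (ltnW ir).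
  have : a (iter i.+1 next_level M0) < a (iter i next_level M0) - delta.
    by rewrite ltNge; apply/negP => h; apply: noi; exists i.
  rewrite -natr1; lra.
have := aC (iter r next_level M0); have := aC M0; lra.
Qed.

(** The step where the average drops by at most [delta] is multiplied by [w * next_level L], which
    lies between [L - 1] and [L]; the missing unit accounts for the term [C]. *)
Lemma exists_chain_psum (f : nat -> R) C delta r M0 : (forall b, 0 <= f b <= C) ->
  0 < delta -> C < r%:R * delta -> (0 < M0)%N ->
  exists2 i, (i < r)%N & let L := iter i next_level M0 in
    psum f L <= w * psum f (next_level L) + C + delta * (next_level L)%:R.
Proof.
move=> fC d0 Cr M00; have /andP[w0 w1] := w01.
have C0 : 0 <= C by have /andP[] := fC 0%N; exact: le_trans.
have f0 b : 0 <= f b by have /andP[] := fC b.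
have aC n : 0 <= psum f n / n%:R <= C.
  rewrite divr_ge0 ?psum_ge0//=; case: n => [|n]; first by rewrite invr0 mulr0.
  by rewrite ler_pdivrMr// mulrC; apply: sum_le_const => b; have /andP[] := fC b.
have [i ir] := @exists_chain_step (fun n => psum f n / n%:R) C delta r M0 aC Cr.
rewrite iterS; set L := iter i next_level M0 => h; exists i => //=.
rewrite -/L.
have L0 : 0 < L%:R :> R by rewrite ltr0n (leq_trans M00)// iter_next_level_ge.
have [LM wM Mw] := next_levelP L.
have M0' : 0 < (next_level L)%:R :> R by rewrite (lt_le_trans L0)// ler_nat.
have /andP[aL0 aL1] := aC L.
have eL : psum f L = psum f L / L%:R * L%:R by rewrite divfK// gt_eqF.
have eM : psum f (next_level L) = psum f (next_level L) / (next_level L)%:R * (next_level L)%:R.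
  by rewrite divfK// gt_eqF.
rewrite eL eM; set aL := (psum f L / _) in h aL0 aL1 *.
set aM := (psum f (next_level L) / _) in h *.
have h1 : (aL - delta) * (w * (next_level L)%:R) <= aM * (w * (next_level L)%:R).
  by rewrite ler_wpM2r// mulr_ge0// ltW.
have h2 : aL * (L%:R - 1) <= aL * (w * (next_level L)%:R) by rewrite ler_wpM2l// ltW.
have h3 : delta * (w * (next_level L)%:R) <= delta * (next_level L)%:R.
  by rewrite ler_wpM2l ?(ltW d0)// ler_piMl// ltW.
lra.
Qed.

End Chain.

(** * Subadditive sequences *)

Section Fekete.
Context {R : realType}.
Variable a : nat -> R.
Hypothesis a0 : forall n, 0 <= a n.
Hypothesis aD : forall m n, a (m + n) <= a m + a n.

Let L := inf [set a n.+1 / n.+1%:R | n in [set: nat]].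

Lemma fekete_le n : (0 < n)%N -> L <= a n / n%:R.
Proof.
case: n => // n _; apply: ge_inf; last by exists n.
by exists 0 => _ [k _ <-]; rewrite divr_ge0.
Qed.

Lemma subadditive_mul q k : a (q * k) <= q%:R * a k + a 0.
Proof.
elim: q => [|q IHq]; first by rewrite mul0n mul0r add0r.
by rewrite mulSn; have := aD k (q * k); rewrite -natr1; lra.
Qed.

Lemma fekete : a n / n%:R @[n --> \oo] --> L.
Proof.
apply/cvgrPdist_le => e e0.
have [_ [k _ <-] kL] : exists2 x, [set a n.+1 / n.+1%:R | n in [set: nat]] x & x < L + e / 2.
  apply: inf_adherent; first by rewrite divr_gt0.
  by split; [exists (a 1 / 1%:R), 0%N|exists 0 => _ [j _ <-]; rewrite divr_ge0].
(* [B] bounds the remainder after division by [k.+1]. It contains [a 0] twice because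
   [subadditive_mul] is used twice and [a 0] need not vanish. *)
set B := a 0 + (a 0 + k.+1%:R * a 1).
near=> n.
have n0 : (0 < n)%N by near: n; exists 1%N.
have nR : 0 < n%:R :> R by rewrite ltr0n.
have Bn : B / n%:R <= e / 2.
  rewrite ler_pdivrMr// mulrC -ler_pdivrMr ?divr_gt0//.
  by near: n; exact: nbhs_infty_ger.
rewrite distrC ger0_norm ?subr_ge0 ?fekete_le// lerBlDl.
have aB : a n <= (n %/ k.+1)%:R * a k.+1 + B.
  rewrite {1}(divn_eq n k.+1) /B.
  have := aD (n %/ k.+1 * k.+1) (n %% k.+1).
  have := subadditive_mul (n %/ k.+1) k.+1.
  have := subadditive_mul (n %% k.+1) 1; rewrite muln1.
  have : (n %% k.+1)%:R * a 1 <= k.+1%:R * a 1 by rewrite ler_wpM2r// ler_nat ltnW// ltn_mod.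
  lra.
have qn : (n %/ k.+1)%:R * a k.+1 <= n%:R * (a k.+1 / k.+1%:R).
  rewrite mulrCA [leLHS]mulrC ler_wpM2l// ler_pdivlMr ?ltr0n// -natrM ler_nat.
  exact: leq_trunc_div.
have : a n / n%:R <= a k.+1 / k.+1%:R + B / n%:R.
  rewrite ler_pdivrMr// mulrDl divfK ?gt_eqF//.
  by apply: le_trans aB _; rewrite lerD2r [leRHS]mulrC.
move: kL; set z := a k.+1 / _; lra.
Unshelve. all: by end_near. Qed.

End Fekete.

(** * Dynamical covers *)

Lemma compact_finite_cover (T : topologicalType) (I : eqType) (U : I -> set T) :
  compact [set: T] -> (forall i, open (U i)) -> (forall x, exists i, U i x) ->
  exists s : seq I, forall x, exists2 i, i \in s & U i x.
Proof.
move=> /compact_near_coveringP cT oU covU.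
(* Finite lists directed by inclusion: near-covering compactness for this filter says that some list
   works for all points at once. *)
pose F : set_system (seq I) :=
  filter_from [set: seq I] (fun s0 : seq I => [set s : seq I | {subset s0 <= s}]).
have FF : Filter F.
  apply: filter_from_filter; first by exists [::].
  move=> s t _ _; exists (s ++ t) => // u /= stu.
  by split=> i ist; apply: stu; rewrite mem_cat ist ?orbT.
have := cT _ F (fun s x => exists2 i, i \in s & U i x) FF.
case=> [x _|s _ /(_ s)]; last first.
  by move=> /(_ (fun _ => id)) h; exists s => x; exact: h.
have [i Ux] := covU x.
exists (U i, [set s : seq I | i \in s]) => /=.
  split; first exact: open_nbhs_nbhs.
  by exists [:: i] => // s /= si; apply: si; rewrite inE.
by move=> [y s] /= [Uy si]; exists i.
Qed.

Lemma open_metric_ball (R : realType) (Z : metricType R) (x : Z) (e : R) :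
  open (ball x e).
Proof.
rewrite openE => y; rewrite ballEmdist /= => xy.
apply/nbhs_ballP; exists (e - mdist x y) => /=; first by rewrite subr_gt0.
move=> z; rewrite !ballEmdist /= => yz.
apply: le_lt_trans (metric_triangle _ y _) _; lra.
Qed.

Section DynamicalCovers.
Context {R : realType} {Z : metricType R}.
Variable f : Z -> Z.
Implicit Types (A B Om : set Z) (n m M N L : nat) (eps : R) (x y z : Z).

Definition dclose N eps x y :=
  forall n, (n < N)%N -> mdist (iter n f x) (iter n f y) < eps.

Definition dball N eps x : set Z := [set y | dclose N eps x y].

(** The uniform bound [c] expresses a supremum strictly below [eps], which pairwise strict
    inequalities would not, and leaves room for thickening. It also holds for the empty set, whose
    [dyndiam] is minus infinity. *)
Definition dsmall N eps A := exists2 c, 0 <= c < eps &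
  forall x y n, A x -> A y -> (n < N)%N -> mdist (iter n f x) (iter n f y) <= c.

Lemma dclose_sym N eps x y : dclose N eps x y -> dclose N eps y x.
Proof. by move=> xy n nN; rewrite metric_sym; exact: xy. Qed.

Lemma dclose_trans N e1 e2 x y z :
  dclose N e1 x y -> dclose N e2 y z -> dclose N (e1 + e2) x z.
Proof.
move=> xy yz n nN; apply: le_lt_trans (metric_triangle _ (iter n f y) _) _.
by rewrite ltrD ?xy ?yz.
Qed.

Lemma dclose_le N N' e e' x y : (N' <= N)%N -> e <= e' ->
  dclose N e x y -> dclose N' e' x y.
Proof.
by move=> NN ee xy n nN; apply: lt_le_trans ee; apply: xy; exact: leq_trans NN.
Qed.

Lemma dclose_refl N eps x : 0 < eps -> dclose N eps x x.
Proof. by move=> e0 n _; rewrite mdistxx. Qed.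

Lemma dclose_iter N M K eps x y : (M + K <= N)%N -> dclose N eps x y ->
  dclose K eps (iter M f x) (iter M f y).
Proof.
move=> MKN xy n nK; rewrite -!iterD; apply: xy.
by rewrite addnC (leq_trans _ MKN)// ltn_add2l.
Qed.

Lemma dyndiamP N eps A : 0 < eps ->
  (dyndiam f N A < eps%:E)%E <-> dsmall N eps A.
Proof.
move=> e0; split => [diamA|[c /andP[c0 ce] Ac]].
  have ub x y : A x -> A y -> ((dynmetric f N x y)%:E <= dyndiam f N A)%E.
    by move=> Ax Ay; apply: ereal_sup_ubound; exists x => //; exists y.
  have [c cA ce] : exists2 c, 0 <= c < eps & (dyndiam f N A <= c%:E)%E.
    move: diamA; case: (dyndiam f N A) => [c| |] //=; last by exists 0; rewrite ?lexx ?leNye.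
    rewrite lte_fin => ce; exists (Num.max 0 c); last by rewrite lee_fin le_max lexx orbT.
    by rewrite le_max lexx /= gt_max e0.
  exists c => // x y n Ax Ay nN.
  have := le_trans (ub x y Ax Ay) ce; rewrite lee_fin; apply: le_trans.
  exact: (le_bigmax _ (fun i : 'I_N => mdist (iter i f x) (iter i f y)) (Ordinal nN)).
apply: (@le_lt_trans _ _ c%:E); last by rewrite lte_fin.
apply: ge_ereal_sup => _ [x Ax [y Ay <-]]; rewrite lee_fin.
by apply: bigmax_le => // i _; exact: Ac.
Qed.

Lemma dsmall_sub N eps A B : A `<=` B -> dsmall N eps B -> dsmall N eps A.
Proof. by move=> AB [c ce Bc]; exists c => // x y n /AB Bx /AB By; exact: Bc. Qed.

Lemma dsmall_le N N' e e' A : (N' <= N)%N -> e <= e' -> dsmall N e A -> dsmall N' e' A.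
Proof.
move=> NN ee [c /andP[c0 ce] Ac]; exists c; first by rewrite c0 (lt_le_trans ce).
by move=> x y n Ax Ay nN; apply: Ac => //; exact: leq_trans NN.
Qed.

Lemma dsmall_close N eps A x y : dsmall N eps A -> A x -> A y -> dclose N eps x y.
Proof.
by move=> [c /andP[c0 ce] Ac] Ax Ay n nN; apply: le_lt_trans ce; exact: Ac.
Qed.

Lemma dsmall_dclose N c eps A : 0 <= c < eps ->
  (forall x y, A x -> A y -> dclose N c x y) -> dsmall N eps A.
Proof. by move=> ce Ac; exists c => // x y n Ax Ay nN; exact/ltW/Ac. Qed.

Lemma dsmall_ball N e eps x : 0 <= e -> 2 * e < eps -> dsmall N eps (dball N e x).
Proof.
move=> e0 ee; apply: (@dsmall_dclose _ (2 * e)); first by rewrite mulr_ge0.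
move=> y z xy xz; rewrite mulr_natl mulr2n; apply: dclose_trans xz.
exact: dclose_sym.
Qed.

Lemma dsmallD M N eps A B : dsmall M eps A -> dsmall N eps B ->
  dsmall (M + N) eps (A `&` iter M f @^-1` B).
Proof.
move=> [c /andP[c0 ce] Ac] [d /andP[d0 de] Bd]; exists (Num.max c d).
  by rewrite le_max c0 /= gt_max ce.
move=> x y n [Ax Bx] [Ay By] nMN; rewrite le_max; case: (ltnP n M) => nM.
  by rewrite Ac.
by rewrite -(subnK nM) !iterD [X in _ || X]Bd ?orbT// -(ltn_add2l M) subnKC.
Qed.

(** The sets need not be open, which makes restriction and intersection free; [dsmall_open] restores
    openness when the cover number of the definition is needed. The empty set gets number 0 without
    a separate case. *)
Definition covered_by N eps Om n := exists2 A : nat -> set Z,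
  (forall k, dsmall N eps (A k)) & forall x, Om x -> exists2 k, (k < n)%N & A k x.

Definition cover_nat N eps Om : nat :=
  xget 0%N [set n | covered_by N eps Om n /\
                    forall m, covered_by N eps Om m -> (n <= m)%N].

Lemma cover_natP N eps Om n : covered_by N eps Om n ->
  covered_by N eps Om (cover_nat N eps Om).
Proof.
move=> covn; have ex : exists n, `[< covered_by N eps Om n >] by exists n; exact/asboolP.
rewrite /cover_nat; case: xgetP => [m _ [] //|].
case: (ex_minnP ex) => m /asboolP covm minm /(_ m) [].
by split => // k covk; apply: minm; exact/asboolP.
Qed.

Lemma cover_nat_le N eps Om n : covered_by N eps Om n ->
  (cover_nat N eps Om <= n)%N.
Proof.
move=> covn; rewrite /cover_nat; case: xgetP => [m _ [_ ]|//]; exact.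
Qed.

Lemma covered_sub N N' e e' Om Om' n n' : Om `<=` Om' -> (N <= N')%N -> e' <= e ->
  (n' <= n)%N -> covered_by N' e' Om' n' -> covered_by N e Om n.
Proof.
move=> OO NN ee nn [A As OA]; exists A => [k|x /OO/OA[k kn Ak]].
  exact: dsmall_le (As k).
by exists k => //; exact: leq_trans nn.
Qed.

Lemma dsmall_set0 N eps : 0 < eps -> dsmall N eps set0.
Proof. by move=> e0; exists 0 => //; rewrite lexx. Qed.

Lemma cover_nat_dsmall N eps Om : dsmall N eps Om -> (cover_nat N eps Om <= 1)%N.
Proof.
by move=> Os; apply: cover_nat_le; exists (fun=> Om) => // x Ox; exists 0%N.
Qed.

Hypothesis fcont : continuous f.
Hypothesis Zcompact : compact [set: Z].

Lemma continuous_iter n : continuous (iter n f).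
Proof.
elim: n => [|n IHn] x; first exact: cvg_id.
apply: (@continuous_comp _ _ _ (iter n f) f); [exact: IHn|exact: fcont].
Qed.

Lemma open_dball N eps x : open (dball N eps x).
Proof.
elim: N => [|N IHN].
  by rewrite (_ : dball _ _ _ = setT) ?predeqE //; exact: openT.
rewrite (_ : dball _ _ _ = dball N eps x `&` iter N f @^-1` ball (iter N f x) eps).
  apply: openI => //; apply: open_comp => [y _|]; first exact: continuous_iter.
  exact: open_metric_ball.
rewrite predeqE => y; rewrite ballEmdist; split => [xy|[xy xyN] n].
  by split=> [n nN|]; apply: xy => //; rewrite (leq_trans nN).
by rewrite ltnS leq_eqVlt => /orP[/eqP->//|/xy].
Qed.

Lemma dsmall_open N eps A : dsmall N eps A ->
  exists U, [/\ open U, A `<=` U & dsmall N eps U].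
Proof.
(* A quarter of the slack: moving both points by [e] raises the bound to [c + 2 * e], still below
   [eps]. *)
move=> [c /andP[c0 ce] Ac]; pose e := (eps - c) / 4.
have e0 : 0 < e by rewrite divr_gt0// subr_gt0.
exists (\bigcup_(x in A) dball N e x); split.
- by apply: bigcup_open => x _; exact: open_dball.
- by move=> x Ax; exists x => //; exact: dclose_refl.
- exists (c + 2 * e); first by rewrite addr_ge0 ?mulr_ge0 ?(ltW e0)//= /e; lra.
  move=> x y n [x' Ax' xx'] [y' Ay' yy'] nN.
  have := Ac x' y' n Ax' Ay' nN; have := ltW (xx' n nN); have := ltW (yy' n nN).
  have := metric_triangle (iter n f x) (iter n f x') (iter n f y).
  have := metric_triangle (iter n f x') (iter n f y') (iter n f y).
  rewrite (metric_sym (iter n f x) (iter n f x')); lra.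
Qed.

Lemma covered_setT N eps : 0 < eps -> exists n, covered_by N eps setT n.
Proof.
move=> e0.
have [x|s sP] := compact_finite_cover Zcompact (open_dball N (eps / 3)).
  by exists x; apply: dclose_refl; rewrite divr_gt0.
exists (size s); exists (fun k => if (k < size s)%N then [set y | exists2 x, nth None (map Some s) k = Some x & dball N (eps / 3) x y] else set0).
  move=> k; case: ifP => ks; last exact: dsmall_set0.
  case E : (nth None (map Some s) k) => [x|].
    apply: (dsmall_sub _ (@dsmall_ball N (eps / 3) eps x _ _)); last 2 first.
    - by rewrite divr_ge0// ltW.
    - lra.
    by move=> y [_ [<-]].
  by apply: (dsmall_sub _ (dsmall_set0 N e0)) => y [].
move=> y _; have [x xs xy] := sP y.
exists (index x s); first by rewrite index_mem.
by rewrite index_mem xs; exists x => //; rewrite (nth_map x) ?index_mem// nth_index.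
Qed.

Lemma cover_nat_covered N eps Om : 0 < eps ->
  covered_by N eps Om (cover_nat N eps Om).
Proof.
move=> e0; have [n covn] := covered_setT N e0.
by apply: (cover_natP (n := n)); exact: covered_sub covn.
Qed.

Lemma le_cover_nat N N' e e' Om Om' : 0 < e' -> Om `<=` Om' -> (N <= N')%N -> e' <= e ->
  (cover_nat N e Om <= cover_nat N' e' Om')%N.
Proof.
move=> e0 OO NN ee; apply: cover_nat_le.
exact: covered_sub (cover_nat_covered N' Om' e0).
Qed.

Lemma cover_nat_gt0 N eps Om : 0 < eps -> Om !=set0 -> (0 < cover_nat N eps Om)%N.
Proof.
move=> e0 [x Ox]; have [A _ /(_ x Ox)[k kn _]] := cover_nat_covered N Om e0.
exact: leq_ltn_trans kn.
Qed.

Lemma cover_nat_set0 N eps : 0 < eps -> cover_nat N eps set0 = 0%N.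
Proof.
move=> e0; apply/eqP; rewrite -leqn0; apply: cover_nat_le.
by exists (fun=> set0) => // k; exact: dsmall_set0.
Qed.

Lemma cover_natD M N eps Om Om' : 0 < eps ->
  (forall x, Om x -> Om' (iter M f x)) ->
  (cover_nat (M + N) eps Om <= cover_nat M eps Om * cover_nat N eps Om')%N.
Proof.
move=> e0 OO'; have [A As OA] := cover_nat_covered M Om e0.
have [B Bs OB] := cover_nat_covered N Om' e0.
set a := cover_nat M _ _ in OA *; set b := cover_nat N _ _ in OB *.
apply: cover_nat_le.
exists (fun k => A (k %/ b)%N `&` iter M f @^-1` (B (k %% b)%N)) => [k|x Ox].
  exact: dsmallD.
have [i ia Ai] := OA x Ox; have [j jb Bj] := OB _ (OO' x Ox).
exists (i * b + j)%N.
  apply: (@leq_trans (i.+1 * b)); first by rewrite mulSn addnC ltn_add2r.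
  by rewrite leq_mul2r ia orbT.
by rewrite divnMDl ?(leq_ltn_trans _ jb)// modnMDl divn_small// modn_small// addn0.
Qed.

Lemma cover_nat_iter L N eps Om (Omb : nat -> set Z) : 0 < eps ->
  (forall b x, (b < L)%N -> Om x -> Omb b (iter (b * N) f x)) ->
  (cover_nat (L * N) eps Om <= \prod_(0 <= b < L) cover_nat N eps (Omb b))%N.
Proof.
move=> e0; elim: L => [|L IHL] OOb.
  rewrite big_geq// mul0n; apply: cover_nat_dsmall.
  by exists 0; rewrite ?lexx.
rewrite big_nat_recr//= mulSn addnC.
apply: (leq_trans (cover_natD (Om' := Omb L) N e0 _)).
  by move=> x Ox; exact: OOb.
rewrite leq_mul2r IHL ?orbT// => b x bL; apply: OOb.
exact: leq_trans bL _.
Qed.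

Lemma cover_nat_bigU N eps Om (I : eqType) (s : seq I) (Omi : I -> set Z) : 0 < eps ->
  (forall x, Om x -> exists2 i, i \in s & Omi i x) ->
  (cover_nat N eps Om <= \sum_(i <- s) cover_nat N eps (Omi i))%N.
Proof.
move=> e0; elim: s Om => [|i s IHs] Om OmU.
  rewrite big_nil -(cover_nat_set0 N e0); apply: le_cover_nat => // x /OmU[] //.
rewrite big_cons; pose Om2 := [set x | exists2 i, i \in s & Omi i x].
apply: (@leq_trans (cover_nat N eps (Omi i) + cover_nat N eps Om2)); last first.
  by rewrite leq_add2l; apply: IHs.
have [A As OA] := cover_nat_covered N (Omi i) e0.
have [B Bs OB] := cover_nat_covered N Om2 e0.
set a := cover_nat N _ _ in OA *; set b := cover_nat N _ _ in OB *.
apply: cover_nat_le; exists (fun k => if (k < a)%N then A k else B (k - a)%N).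
  by move=> k; case: ifP.
move=> x /OmU[j]; rewrite inE => /orP[/eqP->|js] Ox.
  by have [k ka Ak] := OA x Ox; exists k; rewrite ?ka// (leq_trans ka)// leq_addr.
have [|k kb Bk] := OB x; first by exists j.
exists (a + k)%N; first by rewrite ltn_add2l.
by rewrite ltnNge leq_addr /= addKn.
Qed.

Lemma lebesgue_number (I : eqType) (V : I -> set Z) : (forall i, open (V i)) ->
  (forall x, exists i, V i x) ->
  exists2 lam, 0 < lam & forall x, exists i, forall y, mdist x y < lam -> V i y.
Proof.
move=> oV covV.
have h : \forall lam \near (0 : R)^'+, [set: Z] `<=`
    (fun x => exists i, forall y, mdist x y < lam -> V i y); last first.
  near (0 : R)^'+ => lam; exists lam => // x.
  by have /(_ x Logic.I) : [set: Z] `<=`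
    (fun x => exists i, forall y, mdist x y < lam -> V i y) by near: lam.
apply: (iffLR (compact_near_coveringP [set: Z]) Zcompact) => x _.
have [i Vx] := covV x.
have : nbhs x (V i) by apply: open_nbhs_nbhs.
move=> /nbhs_ballP[e /= e0 eV].
exists (ball x (e / 2), [set l | l < e / 2]) => /=.
  split; first by apply: nbhsx_ballx; rewrite divr_gt0.
  by apply: nbhs_right_lt; rewrite divr_gt0.
move=> [y l] /= [xy le]; exists i => z yz; apply: eV.
move: xy; rewrite !ballEmdist /= => xy.
apply: le_lt_trans (metric_triangle _ y _) _; lra.
Unshelve. all: by end_near. Qed.

End DynamicalCovers.

Lemma cover_numE (R : realType) (X : metricType R) (T : X -> X) (Om : set X) N (eps : R) :
  continuous T -> compact [set: X] -> 0 < eps ->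
  cover_num T Om N eps = (cover_nat T N eps Om)%:R%:E.
Proof.
move=> cT cX e0; rewrite /cover_num; case: eqP => [->|/eqP/set0P Om0].
  by rewrite cover_nat_set0.
apply/eqP; rewrite eq_le; apply/andP; split.
  apply: ereal_inf_lbound; exists (cover_nat T N eps Om) => //; split.
    exact: cover_nat_gt0.
  have [A As OA] := cover_nat_covered cT cX N Om e0.
  have /choice[U UP] : forall k, exists U, [/\ open U, A k `<=` U & dsmall T N eps U].
    by move=> k; exact: dsmall_open.
  exists (fun k => U k); split => [k|x /OA[k kn Ak]|k].
  - by have [] := UP k.
  - by exists (Ordinal kn) => //=; have [_ + _] := UP k; exact.
  - by apply/dyndiamP => //; have [] := UP k.
apply: le_ereal_inf_tmp => _ [n [n1 [U [oU OU Us]]] <-]; rewrite lee_fin ler_nat.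
apply: cover_nat_le.
exists (fun k => if insub k is Some i then U i else set0) => [k|x /OU[i _ Ui]].
  by case: insubP => [i _ _|_]; [apply/dyndiamP|exact: dsmall_set0].
by exists i => //; rewrite valK.
Qed.

(** * Weighted cover numbers and the entropy at a fixed radius *)

Section WeightedCovers.
Context {R : realType} {X Y : metricType R}.
Variables (T : X -> X) (S : Y -> Y) (pi : X -> Y) (w : R).
Implicit Types (N M : nat) (eps : R).

Definition small_cover N eps (I : Type) (V : I -> set Y) :=
  [/\ forall i, open (V i), forall y, exists i, V i y & forall i, dsmall S N eps (V i)].

Definition fiber_weight N eps (A : set Y) : R :=
  (cover_nat T N eps (pi @^-1` A))%:R `^ w.

Hypothesis hT : dynamical_system T.
Hypothesis hS : dynamical_system S.
Hypothesis hpi : factor_map T S pi.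
Hypothesis hw : 0 < w.

Lemma ds_compact (Z : metricType R) (f : Z -> Z) : dynamical_system f -> compact [set: Z].
Proof. by case. Qed.

Lemma ds_continuous (Z : metricType R) (f : Z -> Z) : dynamical_system f -> continuous f.
Proof. by case. Qed.

Let cX := ds_compact hT.
Let cY := ds_compact hS.
Let cT := ds_continuous hT.
Let cS := ds_continuous hS.

Lemma factor_iter n x : pi (iter n T x) = iter n S (pi x).
Proof.
have [_ _ piT] := hpi.
elim: n => //= n IHn; rewrite -IHn.
exact: (congr1 (fun g => g (iter n T x)) piT).
Qed.

Lemma factor_surj y : exists x, pi x = y.
Proof.
have [_ rpi _] := hpi.
have : range pi y by rewrite rpi.
by case=> x _; exists x.
Qed.

Lemma fiber_weight_ge1 N eps (A : set Y) : 0 < eps -> A !=set0 ->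
  1 <= fiber_weight N eps A.
Proof.
move=> e0 [y Ay]; have [x xy] := factor_surj y.
apply: (@le_trans _ _ (1 `^ w)); first by rewrite powR1.
rewrite ge0_ler_powR ?nnegrE ?(ltW hw)//.
by rewrite ler1n cover_nat_gt0//; exists x; rewrite /preimage /= xy.
Qed.

Lemma wcover_num_le N eps (I : finType) (V : I -> set Y) : 0 < eps ->
  small_cover N eps V ->
  (wcover_num T S pi w N eps <= (\sum_i fiber_weight N eps (V i))%:E)%E.
Proof.
move=> e0 [oV covV sV]; apply: ereal_inf_lbound.
exists #|I|, (fun k => V (enum_val k)); split => // [| k|].
- rewrite predeqE => y; split => // _; have [i Vi] := covV y.
  by exists (enum_rank i); rewrite ?enum_rankK.
- exact/dyndiamP.
- rewrite -sumEFin (reindex _ (onW_bij _ (enum_val_bij I))) /=.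
  by apply: eq_bigr => k _; rewrite cover_numE// poweR_EFin.
Qed.

Lemma wcover_num_lt N eps (r : \bar R) : 0 < eps ->
  (wcover_num T S pi w N eps < r)%E ->
  exists n (V : 'I_n -> set Y), small_cover N eps V /\
   ((\sum_i fiber_weight N eps (V i))%:E < r)%E.
Proof.
move=> e0 /ereal_inf_lt[_ [n [V [oV covV sV ->]]] ltr].
exists n, V; split.
  split=> // [y|k]; last exact/dyndiamP.
  by have : [set: Y] y by []; rewrite covV => -[k _ Vk]; exists k.
apply: le_lt_trans ltr; rewrite le_eqVlt; apply/orP; left; apply/eqP.
by rewrite -sumEFin; apply: eq_bigr => k _; rewrite cover_numE// poweR_EFin.
Qed.

Lemma small_cover_exists N eps : 0 < eps ->
  exists n (V : 'I_n -> set Y), small_cover N eps V.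
Proof.
move=> e0.
have [y|s sP] := compact_finite_cover cY (open_dball cS N (eps / 3)).
  by exists y; apply: dclose_refl; rewrite divr_gt0.
exists (size s), (fun k => dball S N (eps / 3) (tnth (in_tuple s) k)); split => [k|y|k].
- exact: open_dball.
- have [x xs xy] := sP y.
  have kx : (index x s < size s)%N by rewrite index_mem.
  by exists (Ordinal kx); rewrite (tnth_nth x) nth_index.
- by apply: dsmall_ball; [rewrite divr_ge0// ltW|lra].
Qed.

Lemma fiber_weight_ge0 N eps A : 0 <= fiber_weight N eps A.
Proof. exact: powR_ge0. Qed.

Definition wcover N eps : R := fine (wcover_num T S pi w N eps).

Lemma wcover_num_ge1 N eps : 0 < eps -> (1 <= wcover_num T S pi w N eps)%E.
Proof.
move=> e0; rewrite leNgt; apply/negP => /(wcover_num_lt e0)[n [V [[oV covV _]]]].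
have [[y _] _ _] := hS; have [i Vi] := covV y.
rewrite lte_fin ltNge => /negP; apply.
rewrite (bigD1 i)//= ler_wpDr//; last by apply: fiber_weight_ge1 => //; exists y.
by apply: sumr_ge0 => j _; exact: fiber_weight_ge0.
Qed.

Lemma wcoverE N eps : 0 < eps -> wcover_num T S pi w N eps = (wcover N eps)%:E.
Proof.
move=> e0; have [n [V VP]] := small_cover_exists N e0.
rewrite fineK// ge0_fin_numE; last by rewrite (le_trans _ (wcover_num_ge1 N e0)).
exact: le_lt_trans (wcover_num_le e0 VP) (ltry _).
Qed.

Lemma wcover_ge1 N eps : 0 < eps -> 1 <= wcover N eps.
Proof. by move=> e0; rewrite -lee_fin -wcoverE// wcover_num_ge1. Qed.

Lemma wcover_le N eps (I : finType) (V : I -> set Y) : 0 < eps ->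
  small_cover N eps V -> wcover N eps <= \sum_i fiber_weight N eps (V i).
Proof. by move=> e0 /(wcover_num_le e0); rewrite wcoverE. Qed.

Lemma wcover_lt N eps (r : R) : 0 < eps -> wcover N eps < r ->
  exists n (V : 'I_n -> set Y), small_cover N eps V /\
   \sum_i fiber_weight N eps (V i) < r.
Proof. by move=> e0; rewrite -lte_fin -wcoverE// => /(wcover_num_lt e0). Qed.

Lemma le_wcover N eps eps' : 0 < eps' -> eps' <= eps -> wcover N eps <= wcover N eps'.
Proof.
move=> e0 ee; have e1 : 0 < eps by exact: lt_le_trans ee.
rewrite leNgt; apply/negP => /(wcover_lt e0)[n [V [[oV covV sV]]]].
rewrite ltNge => /negP; apply.
apply: le_trans (wcover_le (V := V) e1 _) _.
  by split=> // i; exact: dsmall_le (sV i).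
apply: ler_sum => i _; rewrite ge0_ler_powR ?nnegrE ?(ltW hw)//.
by rewrite ler_nat le_cover_nat.
Qed.

Lemma fiber_weightD M N eps (A B : set Y) : 0 < eps ->
  fiber_weight (M + N) eps (A `&` iter M S @^-1` B) <=
  fiber_weight M eps A * fiber_weight N eps B.
Proof.
move=> e0; rewrite -powRM// ge0_ler_powR ?nnegrE ?(ltW hw)// ?mulr_ge0//.
rewrite -natrM ler_nat.
apply: leq_trans (cover_natD cT cX (Om' := pi @^-1` B) N e0 _) _.
  by move=> x [_]; rewrite /preimage /= factor_iter.
by rewrite leq_mul2r le_cover_nat ?orbT// => x [].
Qed.

Lemma small_coverD M N eps (I J : Type) (V : I -> set Y) (W : J -> set Y) :
  small_cover M eps V -> small_cover N eps W ->
  small_cover (M + N) eps (fun k : I * J => V k.1 `&` iter M S @^-1` W k.2).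
Proof.
move=> [oV covV sV] [oW covW sW]; split => [k|y|k].
- apply: openI => //; apply: open_comp => // y _; exact: continuous_iter.
- by have [i Vi] := covV y; have [j Wj] := covW (iter M S y); exists (i, j).
- exact: dsmallD.
Qed.

Lemma wcoverD M N eps : 0 < eps -> wcover (M + N) eps <= wcover M eps * wcover N eps.
Proof.
move=> e0.
have pos K : 0 < wcover K eps := lt_le_trans ltr01 (wcover_ge1 K e0).
apply/ler_addgt0Pr => e ee.
(* Only near-optimal covers are available, hence the margin [d]; for [d <= 1] the product exceeds
   [wcover M eps * wcover N eps] by at most [d * s]. *)
have [d d0 dP] : exists2 d : R, 0 < d &
    (wcover M eps + d) * (wcover N eps + d) <= wcover M eps * wcover N eps + e.
  pose s := wcover M eps + wcover N eps + 1.
  have s0 : 0 < s by rewrite !addr_gt0.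
  exists (Num.min 1 (e / s)); first by rewrite lt_min ltr01 divr_gt0.
  set d := Num.min _ _.
  have d1 : d <= 1 by rewrite ge_min lexx.
  have ds : d * s <= e by rewrite -ler_pdivlMr// ge_min lexx orbT.
  have d0 : 0 <= d by rewrite le_min ler01 divr_ge0// ltW.
  have : d * d <= d by rewrite ler_piMr.
  move: ds; rewrite /s; lra.
have [m [V [Vc Vw]]] : exists n (V : 'I_n -> set Y), small_cover M eps V /\
   \sum_i fiber_weight M eps (V i) < wcover M eps + d by apply: wcover_lt => //; rewrite ltrDl.
have [n [W [Wc Ww]]] : exists n (V : 'I_n -> set Y), small_cover N eps V /\
   \sum_i fiber_weight N eps (V i) < wcover N eps + d by apply: wcover_lt => //; rewrite ltrDl.
apply: le_trans (wcover_le e0 (small_coverD Vc Wc)) _; apply: le_trans dP.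
apply: (@le_trans _ _ ((\sum_i fiber_weight M eps (V i)) * (\sum_j fiber_weight N eps (W j)))).
  rewrite mulr_suml -(pair_bigA _ (fun i j => fiber_weight (M + N) eps (V i `&` iter M S @^-1` W j))) /=.
  apply: ler_sum => i _; rewrite mulr_sumr; apply: ler_sum => j _.
  exact: fiber_weightD.
by apply: ler_pM; [| |exact: ltW|exact: ltW];
  apply: sumr_ge0 => i _; exact: fiber_weight_ge0.
Qed.

(** Fekete's limit is an infimum: the lower bound therefore holds at every time, and near-optimal
    times exist. Both directions of the theorem use the entropy at radius [eps] through these
    properties. *)
Lemma htopw_epsP eps : 0 < eps -> exists h : R,
  [/\ htopw_eps T S pi w eps = h%:E, 0 <= h,
      forall N, (0 < N)%N -> expR (h * N%:R) <= wcover N eps &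
      forall d, 0 < d -> exists2 N, (0 < N)%N & wcover N eps < expR ((h + d) * N%:R)].
Proof.
move=> e0; pose a N := ln (wcover N eps).
have pos K : 0 < wcover K eps := lt_le_trans ltr01 (wcover_ge1 K e0).
have a0 N : 0 <= a N by rewrite ln_ge0// wcover_ge1.
have aD M N : a (M + N) <= a M + a N by rewrite /a -lnM ?posrE// ler_ln ?posrE ?mulr_gt0// wcoverD.
have := fekete a0 aD; set h := inf _ => ah.
have hE : htopw_eps T S pi w eps = h%:E.
  rewrite /htopw_eps.
  rewrite (_ : (fun N => _) = (EFin \o (fun N => a N / N%:R))).
    apply: cvg_lim => //; apply/fine_cvgP; split; first exact: nearW.
    exact: ah.
  by apply/funext => N /=; rewrite wcoverE// lne_EFin.
have hle N : (0 < N)%N -> h <= a N / N%:R by exact: fekete_le.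
exists h; split => //.
- apply: lb_le_inf => [|_ [n _ <-]]; last exact: divr_ge0.
  by exists (a 1 / 1%:R), 0%N.
- move=> N N0; rewrite -[leRHS]lnK ?posrE// ler_expR -ler_pdivlMr ?ltr0n//.
  exact: hle.
- move=> d d0; move/cvgrPdist_lt: ah => /(_ d d0) ah.
  near \oo => N; exists N; first by near: N; exists 1%N.
  rewrite -[ltLHS]lnK ?posrE// ltr_expR -ltr_pdivrMr; last first.
    by rewrite ltr0n; near: N; exists 1%N.
  suff : `|h - a N / N%:R| < d by rewrite distrC ltr_norml /a => /andP[_]; lra.
  by near: N; exact: ah.
Unshelve. all: by end_near. Qed.

Lemma le_htopw_eps eps eps' : 0 < eps' -> eps' <= eps ->
  (htopw_eps T S pi w eps <= htopw_eps T S pi w eps')%E.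
Proof.
move=> e0 ee; have e1 : 0 < eps by exact: lt_le_trans ee.
have [h [-> _ hle _]] := htopw_epsP e1; have [h' [-> _ _ hlt]] := htopw_epsP e0.
rewrite lee_fin; apply/ler_addgt0Pr => d /hlt[N N0 ZN].
rewrite -(ler_pM2r (x := N%:R)) ?ltr0n// -ler_expR.
exact: le_trans (hle N N0) (le_trans (le_wcover N e0 ee) (ltW ZN)).
Qed.

End WeightedCovers.

(** * Monotone limits as the radius tends to 0 *)

Section RightLimit.
Context {R : realType}.
Variable f : R -> \bar R.
Hypothesis f_mono : forall e e', 0 < e' -> e' <= e -> (f e <= f e')%E.

Lemma lim_at_right0E :
  lim (f e @[e --> (0 : R)^'+]) = ereal_sup [set f e | e in [set e | 0 < e]].
Proof.
apply: cvg_lim => //.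
have := @nonincreasing_at_right_cvge R f 0 (BInfty _ false) isT.
rewrite (_ : [set` Interval _ _] = [set e | 0 < e]).
  apply=> x y; rewrite !in_itv /= !andbT => x0 y0 xy; exact: f_mono.
by rewrite predeqE => x /=; rewrite in_itv /= andbT.
Qed.

Lemma le_lim_at_right0 e : 0 < e -> (f e <= lim (f e @[e --> (0 : R)^'+]))%E.
Proof. by move=> e0; rewrite lim_at_right0E; apply: ereal_sup_ubound; exists e. Qed.

Lemma lim_at_right0_le (b : \bar R) : (forall e, 0 < e -> (f e <= b)%E) ->
  (lim (f e @[e --> (0 : R)^'+]) <= b)%E.
Proof. by move=> fb; rewrite lim_at_right0E; apply: ge_ereal_sup => _ [e e0 <-]; exact: fb. Qed.

End RightLimit.

(** * Weighted balls *)

Lemma expRN_small (R : realType) (s d : R) : 0 < s -> 0 < d ->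
  exists N, forall n, (N <= n)%N -> expR (- s * n%:R) <= d.
Proof.
move=> s0 d0; exists (Num.truncn (- ln d / s)).+1 => n Nn.
rewrite -[leRHS]lnK ?posrE// ler_expR mulNr lerNl mulrC -ler_pdivrMr//.
by apply: le_trans (ltW (truncnS_gt _)) _; rewrite ler_nat.
Qed.

Lemma ereal_between (R : realType) (h h' : \bar R) : (0 <= h)%E -> (h < h')%E ->
  exists s : R, [/\ 0 <= s, (h < s%:E)%E & (s%:E < h')%E].
Proof.
case: h => [r||] //; last by move=> _; rewrite ltNge leey.
rewrite lee_fin => r0; case: h' => [r'||] //.
  by rewrite lte_fin => rr; exists ((r + r') / 2); rewrite !lte_fin; split; lra.
by move=> _; exists (r + 1); rewrite lte_fin ltry; split=> //; lra.
Qed.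

Section WeightedBalls.
Context {R : realType} {X Y : metricType R}.
Variables (T : X -> X) (S : Y -> Y) (pi : X -> Y) (w : R).
Implicit Types (N n : nat) (eps s : R).

Local Notation ball n x eps := (wball T S pi w (1 - w) n x eps).
Local Notation Lam := (LambdaN T S pi w (1 - w)).
Local Notation Lambda := (Lambda T S pi w (1 - w)).
Local Notation hFH := (htopFH_eps T S pi w (1 - w)).

Lemma wballP n x eps y : ball n x eps y <->
  (forall j : nat, j%:R < w * n%:R -> mdist (iter j T x) (iter j T y) < eps) /\
  dclose S n eps (pi x) (pi y).
Proof.
rewrite /wball /= subrKC mul1r; split => -[hx hy]; split => j.
- by move=> jn; apply: hx; rewrite ceil_gt_int.
- by move=> jn; apply: hy; rewrite ceil_gt_int ltr_nat.
- by rewrite ceil_gt_int; exact: hx.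
- by rewrite ceil_gt_int ltr_nat; exact: hy.
Qed.

Lemma LambdaN_ge0 N eps s : (0 <= Lam N eps s)%E.
Proof.
apply: le_ereal_inf_tmp => _ [x [n [_ _ ->]]].
by apply: nneseries_ge0 => j _ _; rewrite lee_fin expR_ge0.
Qed.

Lemma LambdaN_nd eps s : {homo (fun N => Lam N eps s) : N M / (N <= M)%N >-> (N <= M)%E}.
Proof.
move=> N M NM; apply: le_ereal_inf => z [x [n [h c e]]].
exists x, n; split => // j; have [h0 h1] := h j.
by split => //; exact: leq_trans h1.
Qed.

Lemma LambdaE eps s : Lambda eps s = ereal_sup (range (fun N => Lam N eps s)).
Proof. by apply: cvg_lim => //; apply: ereal_nondecreasing_cvgn; exact: LambdaN_nd. Qed.

Lemma Lambda_ge N eps s : (Lam N eps s <= Lambda eps s)%E.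
Proof. by rewrite LambdaE; apply: ereal_sup_ubound; exists N. Qed.

Lemma Lambda_eq0 eps s :
  (forall N d, 0 < d -> (Lam N eps s <= d%:E)%E) -> Lambda eps s = 0%E.
Proof.
move=> h; apply/eqP; rewrite eq_le (le_trans _ (Lambda_ge 0 eps s)) ?LambdaN_ge0// andbT.
rewrite LambdaE; apply: ge_ereal_sup => _ [N _ <-].
by apply/lee_addgt0Pr => d d0; rewrite add0e; exact: h.
Qed.

(** Raising the exponent multiplies each term by [expR (- (s' - s) * n)], which is at most [d / C]
    once all lengths are large, [C] being a bound for the sum at [s]. *)
Lemma Lambda_vanish eps s s' : s < s' -> (Lambda eps s < +oo)%E -> Lambda eps s' = 0%E.
Proof.
move=> ss' Lfin; apply: Lambda_eq0 => N d d0.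
have [C C0 LC] : exists2 C : R, 0 < C & (Lambda eps s < C%:E)%E.
  move: Lfin (le_trans (LambdaN_ge0 0 eps s) (Lambda_ge 0 eps s)).
  case: (Lambda eps s) => //= r _; rewrite lee_fin => r0.
  by exists (r + 1); rewrite ?lte_fin ?ltrDl// ltr_wpDl.
have [M MP] : exists N, forall n, (N <= n)%N -> expR (- (s' - s) * n%:R) <= d / C.
  by apply: expRN_small; rewrite ?subr_gt0// divr_gt0.
pose K := maxn N M.
have /ereal_inf_lt[_ [x [n [nP covn ->]]] ltC] := le_lt_trans (Lambda_ge K eps s) LC.
apply: (@le_trans _ _ (\sum_(0 <= j <oo) (expR (- s' * (n j)%:R))%:E)%E).
  apply: ereal_inf_lbound; exists x, n; split => // j; have [? Kn] := nP j.
  by split => //; rewrite (leq_trans _ Kn)// leq_maxl.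
apply: (@le_trans _ _ (\sum_(0 <= j <oo) ((d / C)%:E * (expR (- s * (n j)%:R))%:E))%E).
  apply: lee_nneseries => j _; first by rewrite lee_fin expR_ge0.
  rewrite -EFinM lee_fin.
  have -> : - s' * (n j)%:R = - (s' - s) * (n j)%:R + - s * (n j)%:R by ring.
  rewrite expRD ler_wpM2r ?expR_ge0//; apply: MP.
  by have [_] := nP j; apply: leq_trans; rewrite leq_maxr.
rewrite nneseriesZl; last by move=> j _; rewrite lee_fin expR_ge0.
apply: (@le_trans _ _ ((d / C)%:E * C%:E)%E).
  by apply: lee_wpmul2l; [rewrite lee_fin divr_ge0// ltW|exact: ltW].
by rewrite -EFinM lee_fin divfK// gt_eqF.
Qed.

Let critical eps : \bar R := ereal_inf [set s%:E | s in [set s | 0 <= s /\ Lambda eps s = 0%E]].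

(** The infimum satisfies the definition of a critical exponent, and a real number strictly between
    two such exponents would give [Lambda] both values 0 and infinity; so [xget] returns it. *)
Lemma htopFH_epsE eps : hFH eps = critical eps.
Proof.
have crit : is_critical_exponent T S pi w (1 - w) eps (critical eps).
  split.
  - by apply: le_ereal_inf_tmp => _ [s [s0 _] <-]; rewrite lee_fin.
  - move=> s s0 /ereal_inf_lt[_ [s1 [s10 Ls1] <-]]; rewrite lte_fin => s1s.
    by apply: (Lambda_vanish s1s); rewrite Ls1.
  - move=> s s0 ltsc; apply/eqP; rewrite eq_le leey /= leNgt; apply/negP => Ls.
    have [|s' [s'0 ss' s'c]] := ereal_between _ ltsc; first by rewrite lee_fin.
    rewrite lte_fin in ss'.
    move: s'c; rewrite ltNge => /negP; apply; apply: ereal_inf_lbound.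
    by exists s' => //; split => //; exact: Lambda_vanish Ls.
apply: xget_unique => // h [h0 hgt hlt]; have [c0 cgt clt] := crit.
apply/eqP; rewrite eq_le; apply/andP; split; rewrite leNgt; apply/negP => lt.
- have [s [s0 s1 s2]] := ereal_between c0 lt.
  by have := cgt s s0 s1; rewrite (hlt s s0 s2).
- have [s [s0 s1 s2]] := ereal_between h0 lt.
  by have := hgt s s0 s1; rewrite (clt s s0 s2).
Qed.

Lemma htopFH_eps_ge0 eps : (0 <= hFH eps)%E.
Proof.
by rewrite htopFH_epsE; apply: le_ereal_inf_tmp => _ [s [s0 _] <-]; rewrite lee_fin.
Qed.

Lemma htopFH_eps_le eps s : 0 <= s -> Lambda eps s = 0%E -> (hFH eps <= s%:E)%E.
Proof. by move=> s0 Ls; rewrite htopFH_epsE; apply: ereal_inf_lbound; exists s. Qed.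

Lemma htopFH_eps_lt eps s : (hFH eps < s%:E)%E -> Lambda eps s = 0%E.
Proof.
rewrite htopFH_epsE => /ereal_inf_lt[_ [s1 [s10 Ls1] <-]]; rewrite lte_fin => s1s.
by apply: (Lambda_vanish s1s); rewrite Ls1.
Qed.

Lemma sub_wball n x eps eps' : eps <= eps' -> ball n x eps `<=` ball n x eps'.
Proof.
move=> ee y [hx hy]; split => j jn; apply: lt_le_trans ee.
  exact: hx.
exact: hy.
Qed.

Lemma le_htopFH_eps eps eps' : eps <= eps' -> (hFH eps' <= hFH eps)%E.
Proof.
move=> ee; rewrite !htopFH_epsE; apply: le_ereal_inf => _ [s [s0 Ls] <-].
exists s => //; split => //; apply: Lambda_eq0 => N d d0.
have : (Lam N eps s < d%:E)%E by rewrite (le_lt_trans (Lambda_ge N eps s))// Ls lte_fin.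
move=> /ereal_inf_lt[_ [x [n [nP covn ->]]] ltd].
apply: le_trans (ltW ltd); apply: ereal_inf_lbound; exists x, n; split => //.
rewrite predeqE => y; split => // _.
have : [set: X] y by []; rewrite covn => -[j _ yj]; exists j => //.
exact: sub_wball yj.
Qed.

(** [LambdaN] ranges over infinite families. A finite one is padded by balls so long that the [j]-th
    costs at most [d / 2 ^ j.+1]; the factor 2 pays for them. *)
Lemma LambdaN_finite_family N eps s d (fam : seq (X * nat)) : 0 < s -> 0 < d ->
  [set: X] !=set0 ->
  (forall p, p \in fam -> (0 < p.2)%N /\ (N <= p.2)%N) ->
  (forall y, exists2 p, p \in fam & ball p.2 p.1 eps y) ->
  \sum_(p <- fam) expR (- s * p.2%:R) <= d ->
  (Lam N eps s <= (2 * d)%:E)%E.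
Proof.
move=> s0 d0 [x0 _] famN famC famd.
have /choice[t tP] : forall j, exists n, [/\ (0 < n)%N, (N <= n)%N &
    expR (- s * n%:R) <= d / (2 ^ j.+1)%:R].
  move=> j; have [M MP] : exists N, forall n, (N <= n)%N -> expR (- s * n%:R) <= d / (2 ^ j.+1)%:R.
    by apply: expRN_small => //; rewrite divr_gt0// ltr0n expn_gt0.
  exists (maxn 1 (maxn N M)); split; rewrite ?leq_max ?leqnn ?orbT//.
  by apply: MP; rewrite !leq_max leqnn !orbT.
(* The default value of [nth] is the padding ball. *)
pose p j := nth (x0, t j) fam j.
pose A j : \bar R := if (j < size fam)%N then (expR (- s * (p j).2%:R))%:E else 0%E.
have A0 j : (0 <= A j)%E by rewrite /A; case: ifP => //; rewrite lee_fin expR_ge0.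
apply: (@le_trans _ _ (\sum_(0 <= j <oo) (expR (- s * (p j).2%:R))%:E)%E).
  apply: ereal_inf_lbound; exists (fst \o p), (snd \o p); split => //=.
    move=> j; case: (ltnP j (size fam)) => jf; first by apply: famN; exact: mem_nth.
    by rewrite /p nth_default//=; have [] := tP j.
  rewrite predeqE => y; split => // _; have [q qf yq] := famC y.
  exists (index q fam) => //=.
  by rewrite /p (nth_index _ qf).
apply: (@le_trans _ _ (\sum_(0 <= j <oo) (A j + (d / (2 ^ j.+1)%:R)%:E))%E).
  apply: lee_nneseries => j _; first by rewrite lee_fin expR_ge0.
  rewrite /A /p; case: ltnP => jf.
    by rewrite leeDl// lee_fin divr_ge0// ltW.
  by rewrite add0e nth_default//= lee_fin; have [] := tP j.
apply: (le_trans (epsilon_trick _ A0 (ltW d0))).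
rewrite mulr_natl mulr2n EFinD leeD2r//.
rewrite (nneseries_split 0 (size fam))// add0n.
rewrite [X in (_ + X)%E]eseries0; last first.
  by move=> j fj _; rewrite /A ltnNge fj.
rewrite adde0 (@eq_big_nat _ _ _ _ _ _ (fun j => (expR (- s * (nth (x0, 0%N) fam j).2%:R))%:E)); last first.
  by move=> j /andP[_ jf]; rewrite /A jf /p (set_nth_default (x0, 0%N)).
by rewrite sumEFin lee_fin -(big_nth _ xpredT (fun q : X * nat => expR (- s * q.2%:R))).
Qed.

Hypothesis hT : dynamical_system T.
Hypothesis hS : dynamical_system S.
Hypothesis hpi : factor_map T S pi.
Hypothesis hw : 0 < w.

Lemma open_wball n x eps : open (ball n x eps).
Proof.
have [_ _ cT] := hT; have [_ _ cS] := hS; have [cpi _ _] := hpi.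
pose K := `|Num.ceil (w * n%:R)|%N.
have KP j : (j < K)%N = (j%:R < w * n%:R).
  have wn : 0 <= Num.ceil (w * n%:R).
    by rewrite ceil_ge0 (lt_le_trans (ltrN10 R))// mulr_ge0// ltW.
  by rewrite -[RHS](ceil_gt_int _ j%:Z) -(gez0_abs wn).
rewrite (_ : wball _ _ _ _ _ _ _ _ = dball T K eps x `&` pi @^-1` dball S n eps (pi x)).
  apply: openI; first exact: open_dball.
  by apply: open_comp => [y _|]; [exact: cpi|exact: open_dball].
rewrite predeqE => y; rewrite wballP; split => -[hx hy]; split => // j.
  by rewrite KP; exact: hx.
by rewrite -KP; exact: hx.
Qed.

Lemma htopFH_finite_family eps s N : 0 < eps ->
  (htopFH T S pi w (1 - w) < s%:E)%E ->
  exists fam : seq (X * nat), [/\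
    forall p, p \in fam -> (0 < p.2)%N /\ (N <= p.2)%N,
    forall y, exists2 p, p \in fam & ball p.2 p.1 eps y &
    \sum_(p <- fam) expR (- s * p.2%:R) <= 1].
Proof.
move=> e0 hs.
have /htopFH_eps_lt Ls : (hFH eps < s%:E)%E.
  apply: le_lt_trans hs; apply: le_lim_at_right0 => // e e' _; exact: le_htopFH_eps.
have : (Lam N eps s < 1)%E by rewrite (le_lt_trans (Lambda_ge N eps s))// Ls lte01.
move=> /ereal_inf_lt[_ [x [n [nP covn ->]]] lt1].
have [_ cX _] := hT.
have [y|t tP] := compact_finite_cover cX (fun j => open_wball (n j) (x j) eps).
  by have : [set: X] y by []; rewrite covn => -[j _ yj]; exists j.
(* An initial segment containing the subcover is kept, so that its sum is a partial sum of the
   series. *)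
pose K := (\max_(j <- t) j).+1.
exists [seq (x j, n j) | j <- iota 0 K]; split.
- by move=> _ /mapP[j _ ->]; exact: nP.
- move=> y; have [j jt yj] := tP y; exists (x j, n j) => //.
  by apply/mapP; exists j => //; rewrite mem_iota add0n ltnS /=; exact: leq_bigmax_seq.
- rewrite big_map -lee_fin; apply: le_trans (ltW lt1).
  rewrite -sumEFin; have := @nneseries_lim_ge R (fun j => (expR (- s * (n j)%:R))%:E) xpredT 0 K.
  rewrite /index_iota subn0; apply => j _ _; rewrite lee_fin; exact: expR_ge0.
Qed.

End WeightedBalls.

(** * The upper bound *)

Section UpperBound.
Context {R : realType} {X Y : metricType R}.
Variables (T : X -> X) (S : Y -> Y) (pi : X -> Y) (w : R).
Hypothesis hT : dynamical_system T.
Hypothesis hS : dynamical_system S.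
Hypothesis hpi : factor_map T S pi.
Hypothesis hw : 0 < w <= 1.
Implicit Types (N n M L : nat) (eps : R).

Let hw0 : 0 < w. Proof. by case/andP: hw. Qed.

(** The points with a given word [u] of length [M] are cut into sets small up to time [L * N] only.
    As [L >= w * M], such a set lies in one weighted ball of length [M * N]: the word controls the
    orbit in Y. The hypothesis on [psum] bounds the number of pieces by [expR C] times the product
    of the weights of the letters, and the sum over all words is the [M]-th power. *)
Lemma wball_family_of_words N eps n (V : 'I_n -> set Y) L M C : 0 < eps -> (0 < N)%N ->
  small_cover S N eps V -> w * M%:R <= L%:R -> (L <= M)%N ->
  let tau k : R := ln (cover_nat T N eps (pi @^-1` V k))%:R in
  exists fam : seq (X * nat), [/\
    forall p, p \in fam -> p.2 = (M * N)%N,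
    forall y (k : nat -> 'I_n), (forall b, V (k b) (iter (b * N) S (pi y))) ->
      psum (tau \o k) L <= w * psum (tau \o k) M + C ->
      exists2 p, p \in fam & wball T S pi w (1 - w) p.2 p.1 eps y &
    (size fam)%:R <= expR C * (\sum_k fiber_weight T pi w N eps (V k)) ^+ M].
Proof.
move=> e0 N0 [oV covV sV] wML LM tau.
have [[x0 _] cX cT] := hT.
pose K := {ffun 'I_M -> 'I_n}.
pose Xu (u : K) : set X := [set x | forall b : 'I_M, V (u b) (iter (b * N) S (pi x))].
pose tu (u : K) b := if insub b is Some i then tau (u i) else 0.
pose good u := psum (tu u) L <= w * psum (tu u) M + C.
have /choice[A AP] : forall u : K, exists A : nat -> set X,
    (forall k, dsmall T (L * N) eps (A k)) /\
    (forall x, Xu u x -> exists2 k, (k < cover_nat T (L * N) eps (Xu u))%N & A k x).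
  by move=> u; have [A A1 A2] := cover_nat_covered cT cX (L * N) (Xu u) e0; exists A.
(* The centre lies in the piece and has the word [u], so it is close to the other points of the
   piece both in X and in Y. *)
pose pt u j := xget x0 (A u j `&` Xu u).
pose famu u := [seq (pt u j, (M * N)%N) | j <- iota 0 (cover_nat T (L * N) eps (Xu u))].
exists (flatten [seq famu u | u <- enum K & good u]); split.
- by move=> p /flatten_mapP[u _ /mapP[j _ ->]].
- move=> y k ky kC; pose u : K := [ffun b : 'I_M => k b].
  have Xuy : Xu u y by move=> b; rewrite ffunE.
  have tuE b : (b < M)%N -> tu u b = tau (k b).
    by move=> bM; rewrite /tu insubT /= ffunE.
  have goodu : good u.
    have psE m : (m <= M)%N -> psum (tu u) m = psum (tau \o k) m.
      move=> mM; apply: eq_big_nat => b /andP[_ bm] /=.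
      by rewrite tuE// (leq_trans bm).
    by rewrite /good !psE.
  have [As AX] := AP u; have [j jn Ajy] := AX y Xuy.
  exists (pt u j, (M * N)%N).
    apply/flatten_mapP; exists u; first by rewrite mem_filter goodu mem_enum.
    by apply/mapP; exists j; rewrite // mem_iota add0n.
  have [Ajp Xup] : (A u j `&` Xu u) (pt u j) by apply: xgetI; split; [exact: Ajy|].
  apply/wballP => /=; split => [m|m mMN].
    rewrite natrM mulrA => mN.
    have mLN : (m < L * N)%N.
      rewrite -(ltr_nat R) natrM; apply: lt_le_trans mN _.
      by rewrite ler_wpM2r.
    exact: (dsmall_close (As j) Ajp Ajy mLN).
  have qM : (m %/ N < M)%N by rewrite ltn_divLR.
  have rN : (m %% N < N)%N by rewrite ltn_mod.
  rewrite (divn_eq m N) addnC !iterD.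
  exact: (dsmall_close (sV _) (Xup (Ordinal qM)) (Xuy (Ordinal qM)) rN).
- have tau0 k : 0 <= tau k.
    rewrite /tau; case: (cover_nat _ _ _ _) => [|m]; first by rewrite ln0.
    by rewrite ln_ge0// ler1n.
  have key u : good u -> (size (famu u))%:R <=
      expR C * \prod_(b < M) fiber_weight T pi w N eps (V (u b)).
    move=> gu; rewrite size_map size_iota.
    have [->|/set0P[x Xux]] := eqVneq (Xu u) set0.
      by rewrite cover_nat_set0// mulr_ge0 ?expR_ge0// prodr_ge0// => b _; exact: fiber_weight_ge0.
    have t1 (b : 'I_M) : (0 < cover_nat T N eps (pi @^-1` V (u b)))%N.
      apply: cover_nat_gt0 => //; exists (iter (b * N) T x).
      by rewrite /preimage /= (factor_iter hpi).
    pose Ob b : set X := if insub b is Some i then pi @^-1` V (u i) else setT.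
    have -> : \prod_(b < M) fiber_weight T pi w N eps (V (u b)) = expR (w * psum (tu u) M).
      rewrite /psum big_mkord mulr_sumr expR_sum; apply: eq_bigr => b _.
      by rewrite /tu valK /fiber_weight /powR pnatr_eq0 gtn_eqF.
    rewrite -expRD addrC.
    apply: (@le_trans _ _ (expR (psum (tu u) L))); last by rewrite ler_expR.
    have := cover_nat_iter cT cX (L := L) (N := N) (Om := Xu u) (Omb := Ob) e0.
    move=> /(_ _)/wrap[b z bL Xz|].
      rewrite /Ob insubT ?(leq_trans bL)// => bM.
      by rewrite /preimage /= (factor_iter hpi); exact: (Xz (Ordinal bM)).
    rewrite -(ler_nat R) => /le_trans; apply.
    rewrite natr_prod /psum expR_sum le_eqVlt; apply/orP; left; apply/eqP.
    apply: eq_big_nat => b /andP[_ bL]; rewrite /Ob /tu insubT ?(leq_trans bL)// => bM /=.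
    by rewrite lnK// posrE ltr0n.
  rewrite size_flatten /shape -map_comp sumnE big_map big_filter natr_sum.
  apply: (@le_trans _ _ (\sum_(u <- enum K | good u) expR C * \prod_(b < M) fiber_weight T pi w N eps (V (u b)))).
    by apply: ler_sum => u gu; exact: key.
  rewrite -mulr_sumr ler_wpM2l ?expR_ge0//.
  have -> : (\sum_k fiber_weight T pi w N eps (V k)) ^+ M =
      \sum_(u : K) \prod_(b < M) fiber_weight T pi w N eps (V (u b)).
    by rewrite -[M in LHS]card_ord -prodr_const bigA_distr_bigA.
  rewrite -[leRHS]big_enum /= [leRHS](bigID good) /= lerDl sumr_ge0// => u _.
  by rewrite prodr_ge0// => b _; exact: fiber_weight_ge0.
Qed.

Lemma htopFH_eps_le_htopw_eps eps : 0 < eps ->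
  (htopFH_eps T S pi w (1 - w) eps <= htopw_eps T S pi w eps)%E.
Proof.
move=> e0; have [h [-> h0 _ hlt]] := htopw_epsP hT hS hpi hw0 e0.
have [X0 cX cT] := hT.
apply/lee_addgt0Pr => e ee; rewrite -EFinD.
apply: htopFH_eps_le; first by rewrite addr_ge0// ltW.
apply: Lambda_eq0 => N0 d d0.
have [|N NN0 Ne] := hlt (e / 4); first by rewrite divr_gt0.
have [n [V [Vc Vw]]] := wcover_lt hT hS hpi hw0 e0 Ne.
have [oV covV sV] := Vc.
pose C : R := ln (cover_nat T N eps setT)%:R.
have cpos : (0 < cover_nat T N eps setT)%N by apply: cover_nat_gt0.
pose tau k : R := ln (cover_nat T N eps (pi @^-1` V k))%:R.
have tauC k : 0 <= tau k <= C.
  rewrite /tau /C.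
  have := @le_cover_nat R X T cT cX N N eps eps (pi @^-1` V k) setT e0.
  move=> /(_ (@subsetT _ _) (leqnn _) (lexx _)).
  case: (cover_nat _ _ _ (_ @^-1` _)) => [_|m mC]; first by rewrite ln0// lexx ln_ge0// ler1n.
  by rewrite ln_ge0 ?ler1n//= ler_ln ?posrE ?ltr0n// ler_nat.
have e4 : 0 < e / 4 by rewrite divr_gt0.
(* Averages bounded by [C] cannot drop by [e / 4] at [r] successive levels, so the families of [r]
   levels together catch every point. *)
have [r r0 Cr] : exists2 r, (0 < r)%N & C < r%:R * (e / 4).
  by exists (Num.truncn (C / (e / 4))).+1; rewrite // -ltr_pdivrMr// truncnS_gt.
have e2 : 0 < e / 2 by rewrite divr_gt0.
have dr : 0 < d / 2 / (r%:R * expR C) by rewrite !divr_gt0// mulr_gt0 ?ltr0n ?expR_gt0.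
have [M1 M1P] := expRN_small e2 dr.
pose M0 := maxn 1 (maxn N0 M1).
pose L i := iter i (next_level w) M0.
pose M i := next_level w (L i).
have LM0 i : (M0 <= L i)%N by exact: iter_next_level_ge.
have LM i : (L i <= M i)%N by have [] := next_levelP hw (L i).
have /choice[fam famP] : forall i, exists fam : seq (X * nat), [/\
    forall p, p \in fam -> p.2 = (M i * N)%N,
    forall y (k : nat -> 'I_n), (forall b, V (k b) (iter (b * N) S (pi y))) ->
      psum (tau \o k) (L i) <= w * psum (tau \o k) (M i) + (C + e / 4 * (M i)%:R) ->
      exists2 p, p \in fam & wball T S pi w (1 - w) p.2 p.1 eps y &
    (size fam)%:R <= expR (C + e / 4 * (M i)%:R) * (\sum_k fiber_weight T pi w N eps (V k)) ^+ M i].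
  move=> i; apply: wball_family_of_words => //.
  by have [_ + _] := next_levelP hw (L i).
rewrite (_ : d = 2 * (d / 2)); last by rewrite mulrC divfK.
apply: (@LambdaN_finite_family _ _ _ _ _ _ _ _ _ _ _ (flatten [seq fam i | i <- iota 0 r])) => //.
- by rewrite ltr_wpDl.
- by rewrite divr_gt0.
- move=> p /flatten_mapP[i _ pi_]; have [p2 _ _] := famP i; rewrite (p2 _ pi_).
  have M0M : (M0 <= M i)%N by rewrite (leq_trans (LM0 i)).
  have M1' : (0 < M i)%N by rewrite (leq_trans _ M0M)// leq_max.
  split; first by rewrite muln_gt0 M1'.
  by rewrite (leq_trans _ (leq_pmulr _ NN0))// (leq_trans _ M0M)// !leq_max leqnn orbT.
- move=> y.
  have /choice[k kP] : forall b, exists k, V k (iter (b * N) S (pi y)) by move=> b; exact: covV.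
  have [|i ir] := @exists_chain_psum R w hw (tau \o k) C (e / 4) r M0 (fun b => tauC (k b)) e4 Cr.
    by rewrite leq_max.
  rewrite /= -/(L i) -/(M i) => Li.
  have [_ + _] := famP i => /(_ y k kP)[|p pf yp]; first by rewrite addrA.
  exists p; last exact: yp.
  by apply/flatten_mapP; exists i => //; rewrite mem_iota add0n.
- set W := \sum_k _ in Vw famP.
  have stage i : \sum_(p <- fam i) expR (- (h + e) * p.2%:R) <= d / 2 / r%:R.
    have [p2 _ sz] := famP i.
    rewrite big_seq (eq_bigr (fun=> expR (- (h + e) * (M i * N)%:R))); last first.
      by move=> p /p2 ->.
    rewrite -big_seq big_const_seq count_predT iter_addr_0 -[leLHS]mulr_natl.
    have W0 : 0 <= W by apply: sumr_ge0 => j _; exact: fiber_weight_ge0.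
    have WM : W ^+ M i <= expR ((h + e / 4) * N%:R * (M i)%:R).
      by rewrite expRM_natr lerXn2r ?nnegrE ?expR_ge0// ltW.
    (* As [N >= 1], the exponent [e/4 M + (h + e/4) N M - (h + e) N M] is at most [- e/2 M], and
       [M >= M1] makes the cost of one level at most [d / 2 / r]. *)
    apply: (@le_trans _ _ (expR C * expR (- (e / 2) * (M i)%:R))); last first.
      have M1i : (M1 <= M i)%N.
        by rewrite (leq_trans _ (LM i))// (leq_trans _ (LM0 i))// !leq_max leqnn !orbT.
      have := M1P _ M1i; rewrite !ler_pdivlMr ?ltr0n ?mulr_gt0 ?ltr0n ?expR_gt0//.
      by move: (expR _) (expR C) r%:R => ? ? ?; lra.
    apply: (@le_trans _ _ (expR (C + e / 4 * (M i)%:R) * expR ((h + e / 4) * N%:R * (M i)%:R)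
        * expR (- (h + e) * (M i * N)%:R))).
      rewrite ler_wpM2r ?expR_ge0//; apply: le_trans sz _.
      by rewrite ler_wpM2l ?expR_ge0.
    rewrite -!expRD ler_expR natrM.
    have : (M i)%:R <= (M i)%:R * N%:R :> R by rewrite ler_peMr// ler1n.
    move=> /(ler_wpM2l (ltW ee)); lra.
  rewrite big_flatten big_map /=.
  apply: (@le_trans _ _ (\sum_(i <- iota 0 r) d / 2 / r%:R)); first by apply: ler_sum => i _.
  rewrite big_const_seq count_predT iter_addr_0 size_iota -[leLHS]mulr_natl mulrC divfK//.
  by rewrite pnatr_eq0 -lt0n.
Qed.

Lemma htopFH_le_htopw :
  (htopFH T S pi w (1 - w) <= htopw T S pi w)%E.
Proof.
apply: lim_at_right0_le => [e e' _|e e0]; first exact: le_htopFH_eps.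
apply: (le_trans (htopFH_eps_le_htopw_eps e0)).
exact: le_lim_at_right0 (le_htopw_eps hT hS hpi hw0) _ e0.
Qed.

End UpperBound.

(** * The lower bound *)

Section TileMembership.
Context {R : realType} {I : eqType}.
Variables (p : I -> nat) (c : I -> nat -> bool).
Implicit Types (J : seq I) (b : nat).

(* The position of b inside the tile of J containing it is selected by c. *)
Fixpoint in_tile J b : bool :=
  if J is j :: J' then
    if (b < p j)%N then c j b else in_tile J' (b - p j)
  else false.

Lemma follows_rel (Z : Type) (g : Z -> Z) (B : I -> set Z) (r : seq I)
    (D : Z -> Z -> Prop) :
  (forall j b z z', j \in r -> B j z -> B j z' -> (b < p j)%N -> c j b ->
     D (iter b g z) (iter b g z')) ->
  forall J b z z', {subset J <= r} -> follows p g B J z -> follows p g B J z' ->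
    in_tile J b -> D (iter b g z) (iter b g z').
Proof.
move=> BD; elim=> [//|j J IHJ] b z z' Jr /= [Bz Jz] [Bz' Jz'].
case: ltnP => [bp cb|pb].
  by apply: BD Bz Bz' bp cb; rewrite Jr// mem_head.
move=> Jb; rewrite -(subnK pb) !iterD; apply: IHJ => // i iJ.
by apply: Jr; rewrite inE iJ orbT.
Qed.

Lemma free_sum_in_tile (q : I -> nat) (f : nat -> R) a J :
  (forall j b, c j b = (b < q j)%N) -> {in J, forall j, (q j <= p j)%N} ->
  \sum_(0 <= b < code_length p J) (if in_tile J b then 0 else f (a + b)%N)
    = free_sum f a [seq (p j, q j) | j <- J].
Proof.
move=> cq; elim: J a => [|j J IHJ] a qp /=.
  by rewrite /code_length big_nil big_geq.
rewrite /code_length big_cons -/(code_length p J).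
have qpj : (q j <= p j)%N by rewrite qp// mem_head.
rewrite (big_cat_nat (leq0n (p j)) (leq_addr _ _)) /=; congr (_ + _).
  rewrite (big_cat_nat (leq0n (q j)) qpj) /= big_nat big1 ?add0r; last first.
    by move=> b /andP[_ bq]; rewrite cq bq (leq_trans bq).
  rewrite -{1}[q j]add0n big_addn -[(a + q j)%N]add0n big_addn subnDl.
  apply: eq_big_nat => b /andP[_ bpq].
  have -> : (b + q j < p j)%N by rewrite addnC -ltn_subRL.
  by rewrite cq ltnNge leq_addl /=; congr f; lia.
rewrite -IHJ; last by move=> i iJ; apply: qp; rewrite inE iJ orbT.
rewrite -{1}[p j]add0n big_addn addKn; apply: eq_big_nat => b _.
by rewrite ltnNge leq_addl /= addnK; case: ifP => // _; congr f; lia.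
Qed.

End TileMembership.

Lemma in_tileT (I : eqType) (p : I -> nat) J b :
  (b < code_length p J)%N -> in_tile p (fun _ _ => true) J b.
Proof.
elim: J b => [|j J IHJ] b /=; first by rewrite /code_length big_nil.
rewrite /code_length big_cons; case: (ltnP b (p j)) => // pb bpJ; apply: IHJ.
by rewrite -(ltn_add2l (p j)) subnKC.
Qed.

(** * Cover numbers bounded by the number of codes *)

Section TilingCover.
Context {R : realType} {Z : metricType R} {I : eqType}.
Variables (f : Z -> Z) (r : seq I) (p : I -> nat) (B : I -> set Z).

Lemma cover_nat_tiling (c e eps : R) pm M : 0 <= c -> 0 <= e -> e < eps ->
  (forall j, j \in r -> (0 < p j <= pm)%N) ->
  (forall z, exists2 j, j \in r & B j z) ->
  (forall j z z', j \in r -> B j z -> B j z' -> dclose f (p j) e z z') ->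
  \sum_(j <- r) expR (- c * (p j)%:R) <= 1 ->
  (cover_nat f M eps setT)%:R <= expR (c * (M + pm)%:R).
Proof.
move=> c0 e0 ee pP covB Bclose sum1.
apply: le_trans (size_codes_le M M c0 _ sum1); last first.
  by move=> j /pP/andP[].
rewrite ler_nat; apply: cover_nat_le.
pose A J : set Z := if J \in codes r p M M then [set z | follows p f B J z] else set0.
exists (fun k => A (nth [::] (codes r p M M) k)) => [k|z _].
  rewrite /A; case: ifP => [Jc|_]; last by apply: dsmall_set0; exact: le_lt_trans ee.
  have [Jr MJ] := mem_codes Jc.
  apply: (@dsmall_dclose _ _ _ _ e); first by rewrite e0.
  move=> z z' Jz Jz' b bM.
  apply: (@follows_rel I p (fun _ _ => true) _ f B r
    (fun z z' => mdist z z' < e) _ _ b z z' Jr Jz Jz').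
    by move=> j b' u u' jr Bu Bu' bp _; exact: (Bclose j u u' jr Bu Bu').
  by apply: in_tileT; exact: leq_trans MJ.
have [|J Jc Jz] := @codes_cover I r p Z f B _ covB M M z (leqnn _).
  by move=> j /pP/andP[].
exists (index J (codes r p M M)); first by rewrite index_mem.
by rewrite nth_index// /A Jc.
Qed.

End TilingCover.

(** * Finiteness of the weighted entropy *)

Section Finiteness.
Context {R : realType} {X Y : metricType R}.
Variables (T : X -> X) (S : Y -> Y) (pi : X -> Y) (w : R).
Hypothesis hT : dynamical_system T.
Hypothesis hS : dynamical_system S.
Hypothesis hpi : factor_map T S pi.
Hypothesis hw : 0 < w <= 1.

Let hw0 : 0 < w. Proof. by case/andP: hw. Qed.

Lemma wball_close n x eps y y' : wball T S pi w (1 - w) n x eps y ->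
  wball T S pi w (1 - w) n x eps y' ->
  (forall j, j%:R < w * n%:R -> mdist (iter j T y) (iter j T y') < 2 * eps) /\
  dclose S n (2 * eps) (pi y) (pi y').
Proof.
move=> /wballP[x1 y1] /wballP[x2 y2]; split; last first.
  by rewrite mulr_natl mulr2n; apply: dclose_trans y2; exact: dclose_sym.
move=> j jn; apply: le_lt_trans (metric_triangle _ (iter j T x) _) _.
have := x1 j jn; rewrite metric_sym; have := x2 j jn; lra.
Qed.

Lemma cover_nat_small_cover N eps : 0 < eps ->
  exists V : 'I_(cover_nat S N eps setT) -> set Y, small_cover S N eps V.
Proof.
move=> e0; have [_ cY cS] := hS.
have [A As YA] := cover_nat_covered cS cY N setT e0.
have /choice[U UP] : forall k, exists U, [/\ open U, A k `<=` U & dsmall S N eps U].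
  by move=> k; exact: dsmall_open.
exists (fun k => U k); split => [k|y|k]; try by have [] := UP k.
by have [k kn Ak] := YA y Logic.I; exists (Ordinal kn); have [_ + _] := UP k; exact.
Qed.

(** Only finiteness matters here: it makes the term (1-w)h of the interpolation cancellable. A
    weighted ball controls Y for time [n] and X for time about [w * n], so tilings cover Y at rate
    [s] and X at rate [s / w]. *)
Lemma htopw_lty (s : R) : 0 <= s -> (htopFH T S pi w (1 - w) < s%:E)%E ->
  (htopw T S pi w <= (s + s / w)%:E)%E.
Proof.
move=> s0 hs; apply: lim_at_right0_le => [e e'|eps e0]; first exact: le_htopw_eps.
have [h [-> h0 hle _]] := htopw_epsP hT hS hpi hw0 e0.
have [cY cS] := (ds_compact hS, ds_continuous hS).
have e3 : 0 < eps / 3 by rewrite divr_gt0.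
have [fam [famN famC fam1]] := htopFH_finite_family hT hS hpi hw0 0 e3 hs.
pose nm := (\max_(j <- fam) j.2)%N.
have nmP j : j \in fam -> (j.2 <= nm)%N.
  by move=> jf; exact: (@leq_bigmax_seq _ fam xpredT (fun j : X * nat => j.2) j jf isT).
(* Rounding up keeps the tiles nonempty and makes [k < l j] mean exactly that the ball controls time
   [k] in X. *)
pose l (j : X * nat) := `|Num.ceil (w * j.2%:R)|%N.
have lP (j : X * nat) k : (k < l j)%N = (k%:R < w * j.2%:R).
  have wn : 0 <= Num.ceil (w * j.2%:R).
    by rewrite ceil_ge0 (lt_le_trans (ltrN10 R))// mulr_ge0// ltW.
  by rewrite -[RHS](ceil_gt_int _ k%:Z) -(gez0_abs wn).
have l_ge (j : X * nat) : w * j.2%:R <= (l j)%:R by rewrite leNgt -lP ltnn.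
have l_le (j : X * nat) : (l j <= j.2)%N.
  rewrite leqNgt lP -leNgt ler_piMl//; by case/andP: hw.
have l_gt0 (j : X * nat) : (0 < j.2)%N -> (0 < l j)%N.
  by move=> j0; rewrite lP mulr_gt0// ltr0n.
pose B (j : X * nat) := wball T S pi w (1 - w) j.2 j.1 (eps / 3).
have covX M : (cover_nat T M eps setT)%:R <= expR (s / w * (M + nm)%:R).
  apply: (@cover_nat_tiling R X _ T fam l B (s / w) (2 * (eps / 3))) => //.
  - by rewrite divr_ge0// ltW.
  - by rewrite mulr_ge0// ltW.
  - lra.
  - by move=> j jf; rewrite l_gt0 ?(leq_trans (l_le j)) ?nmP//; case: (famN j jf).
  - move=> j z z' _ Bz Bz' k kl; have [+ _] := wball_close Bz Bz'.
    by apply; rewrite -lP.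
  - apply: le_trans fam1; apply: ler_sum => j _; rewrite ler_expR !mulNr lerN2.
    by rewrite mulrAC ler_pdivlMr// -mulrA ler_wpM2l// mulrC.
have covY M : (cover_nat S M eps setT)%:R <= expR (s * (M + nm)%:R).
  apply: (@cover_nat_tiling R Y _ S fam snd (fun j => pi @` B j) s (2 * (eps / 3))) => //.
  - by rewrite mulr_ge0// ltW.
  - lra.
  - by move=> j jf; rewrite nmP// andbT; case: (famN j jf).
  - move=> y; have [x <-] := factor_surj hpi y; have [j jf Bx] := famC x.
    by exists j => //; exists x.
  - by move=> j _ _ _ [z Bz <-] [z' Bz' <-]; have [] := wball_close Bz Bz'.
rewrite lee_fin.
have bound M : (0 < M)%N -> h * M%:R <= (s + s / w) * M%:R + (s + s / w) * nm%:R.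
  move=> M0; rewrite -mulrDr -natrD -ler_expR; apply: le_trans (hle M M0) _.
  have [V Vc] := cover_nat_small_cover M e0.
  apply: le_trans (wcover_le hT hS hpi hw0 e0 Vc) _.
  rewrite mulrDl expRD.
  apply: (@le_trans _ _ (\sum_(i < cover_nat S M eps setT) expR (s / w * (M + nm)%:R))).
    apply: ler_sum => i _; apply: le_trans (covX M).
    have [V0|/set0P V0] := eqVneq (pi @^-1` V i) set0.
      by rewrite /fiber_weight V0 cover_nat_set0// powR0 ?gt_eqF.
    have [cX cT] := (ds_compact hT, ds_continuous hT).
    apply: (@le_trans _ _ (cover_nat T M eps (pi @^-1` V i))%:R).
      by rewrite /fiber_weight ler1_powR//; [rewrite ler1n cover_nat_gt0|case/andP: hw].
    by rewrite ler_nat le_cover_nat.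
  by rewrite sumr_const card_ord -[leLHS]mulr_natl ler_wpM2r ?expR_ge0.
apply/ler_addgt0Pr => d d0.
set C := (s + s / w) * nm%:R in bound.
have C0 : 0 <= C by rewrite mulr_ge0// addr_ge0// divr_ge0// ltW.
pose M := (Num.truncn (C / d)).+1.
have CM : C <= d * M%:R by rewrite mulrC -ler_pdivrMr// ltW// truncnS_gt.
have MR : 0 < M%:R :> R by rewrite ltr0n.
rewrite -(ler_pM2r MR) mulrDl; apply: le_trans (bound M isT) _.
by rewrite lerD2l.
Qed.

End Finiteness.

(** A crude form of Young's inequality, through the maximum of [x] and [y]; the lost constant does
    not affect exponential rates. *)
Lemma powR_mul_le_add (R : realType) (w x y : R) : 0 <= x -> 0 <= y -> 0 <= w <= 1 ->
  x `^ w * y `^ (1 - w) <= x + y.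
Proof.
move=> x0 y0 /andP[w0 w1]; pose m := Num.max x y.
have m0 : 0 <= m by rewrite le_max x0.
apply: (@le_trans _ _ m); last by rewrite ge_max; apply/andP; split; lra.
have -> : m = m `^ w * m `^ (1 - w).
  by rewrite -powRD ?subrKC ?powRr1// oner_eq0.
apply: ler_pM; rewrite ?powR_ge0// ge0_ler_powR ?nnegrE ?subr_ge0// le_max lexx ?orbT//.
Qed.

Lemma iter_mul (A : Type) (f : A -> A) n m x :
  iter n (iter m f) x = iter (n * m) f x.
Proof. by elim: n => //= n ->; rewrite mulSn iterD. Qed.

Definition separated (R : realType) (Y : metricType R) (S : Y -> Y) N (eta : R)
    (G : seq Y) :=
  uniq G /\ {in G &, forall y y', dclose S N eta y y' -> y = y'}.

Definition tile_blocks (X : Type) K0 (j : X * nat) := (j.2 %/ K0)%N.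

(** Time is counted in blocks of [K0] steps. These are the initial blocks of a tile on which its
    ball controls the orbit in X; rounding down keeps them entirely inside the controlled time. *)
Definition base_blocks (R : realType) (X : Type) (w : R) K0 (j : X * nat) :=
  Num.truncn (w * (tile_blocks K0 j)%:R).

(** * Codes followed in a tube *)

Section TubeCounting.
Context {R : realType} {X Y : metricType R}.
Variables (T : X -> X) (S : Y -> Y) (pi : X -> Y) (w : R).
Hypothesis hT : dynamical_system T.
Hypothesis hS : dynamical_system S.
Hypothesis hpi : factor_map T S pi.
Hypothesis hw : 0 < w <= 1.

Let hw0 : 0 < w. Proof. by case/andP: hw. Qed.
Let cX := ds_compact hT.
Let cT := ds_continuous hT.

Implicit Types (fam J : seq (X * nat)).

Variables (K0 : nat).
Hypothesis K00 : (0 < K0)%N.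

Local Notation p := (tile_blocks K0).
Local Notation q := (base_blocks w K0).

Let q_le (j : X * nat) : (q j)%:R <= w * (p j)%:R.
Proof. by have /andP[] := truncn_itv (mulr_ge0 (ltW hw0) (ler0n R (p j))). Qed.

Let qp (j : X * nat) : (q j <= p j)%N.
Proof.
rewrite -(ler_nat R); apply: le_trans (q_le j) _.
by rewrite ler_piMl//; case/andP: hw.
Qed.

Lemma block_family (s d eps : R) N : 0 <= s -> 0 < d -> 0 < eps ->
  (htopFH T S pi w (1 - w) < s%:E)%E ->
  exists fp : seq (X * nat) * nat, [/\
    forall j, j \in fp.1 -> (0 < p j)%N /\ (N <= p j <= fp.2)%N,
    forall x, exists2 j, j \in fp.1 & wball T S pi w (1 - w) j.2 j.1 eps x &
    \sum_(j <- fp.1) expR (- (s * K0%:R + d) * (p j)%:R) <= 1].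
Proof.
move=> s0 d0 e0 hs.
(* Counting whole blocks loses at most [s * K0] in the exponent of a tile; [d * p j] pays for it
   once [p j] exceeds [s * K0 / d]. *)
pose N1 := (maxn N (maxn 1 (Num.truncn (s * K0%:R / d)).+1)).
have [fam [famN famC fam1]] := htopFH_finite_family hT hS hpi hw0 (N1 * K0) e0 hs.
exists (fam, (\max_(j <- fam) p j)%N) => /=; split => //.
- move=> j jf; have [_ Nj] := famN j jf.
  have N1p : (N1 <= p j)%N by rewrite /tile_blocks leq_divRL.
  split; first by rewrite (leq_trans _ N1p)// /N1 !leq_max leqnn ?orbT.
  rewrite (leq_trans _ N1p) ?leq_maxl//=.
  exact: (@leq_bigmax_seq _ fam xpredT p j jf isT).
- apply: le_trans fam1; rewrite big_seq [leRHS]big_seq; apply: ler_sum => j jf.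
  have [_ Nj] := famN j jf.
  have N1p : (N1 <= p j)%N by rewrite /tile_blocks leq_divRL.
  rewrite ler_expR !mulNr lerN2.
  have sp : s * K0%:R <= d * (p j)%:R.
    rewrite mulrC [leRHS]mulrC -ler_pdivrMr// mulrC.
    apply: ltW; apply: (lt_le_trans (truncnS_gt _)).
    by rewrite ler_nat (leq_trans _ N1p)// !leq_max leqnn !orbT.
  have jp : j.2%:R <= (p j)%:R * K0%:R + K0%:R :> R.
    rewrite -natrM -natrD ler_nat {1}(divn_eq j.2 K0) leq_add2l ltnW// ltn_mod//.
  have := ler_wpM2l s0 jp; lra.
Qed.

Variables (eps e1 lam eta : R).
Hypotheses (eps0 : 0 < eps) (eps_e1 : 2 * eps < e1) (lam0 : 0 < lam).
Hypothesis sep : 2 * lam + 2 * eps <= eta.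

Let e10 : 0 < e1. Proof. by move: eps0 eps_e1; lra. Qed.

Local Notation B := (fun j : X * nat => wball T S pi w (1 - w) j.2 j.1 eps).
Local Notation g := (iter K0 T).

Let follows_fiber fam J m z z' : {subset J <= fam} -> (m <= code_length p J)%N ->
  follows p g B J z -> follows p g B J z' -> dclose S (m * K0) (2 * eps) (pi z) (pi z').
Proof.
move=> Jf mJ Jz Jz' n nm.
have nK : (n %/ K0 < m)%N by rewrite ltn_divLR.
have h : dclose S K0 (2 * eps) (pi (iter (n %/ K0) g z)) (pi (iter (n %/ K0) g z')).
  apply: (@follows_rel _ p (fun _ _ => true) X g B fam
    (fun z z' => dclose S K0 (2 * eps) (pi z) (pi z')) _ J _ z z' Jf Jz Jz').
    move=> j b u u' _ Bu Bu' bp _; have [_ uu'] := wball_close Bu Bu'.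
    rewrite !iter_mul !(factor_iter hpi); apply: dclose_iter uu'.
    by rewrite addnC -mulSn -leq_divRL.
  exact: in_tileT (leq_trans nK mJ).
have := h (n %% K0)%N (ltn_pmod _ K00).
by rewrite !iter_mul !(factor_iter hpi) -!iterD addnC -divn_eq.
Qed.

Let follows_base fam J b z z' : {subset J <= fam} ->
  follows p g B J z -> follows p g B J z' -> in_tile p (fun j b => b < q j)%N J b ->
  dclose T K0 (2 * eps) (iter (b * K0) T z) (iter (b * K0) T z').
Proof.
move=> Jf Jz Jz' Jb; rewrite -!iter_mul.
apply: (@follows_rel _ p _ X g B fam (dclose T K0 (2 * eps)) _ J b z z' Jf Jz Jz' Jb).
move=> j b' u u' _ Bu Bu' _ bq; have [uu' _] := wball_close Bu Bu'.
rewrite !iter_mul => i iK; rewrite -!iterD; apply: uu'.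
apply: (@lt_le_trans _ _ ((q j)%:R * K0%:R)).
  by rewrite -natrM ltr_nat addnC (leq_trans _ (leq_mul bq (leqnn K0)))// mulSn addnC ltn_add2r.
apply: le_trans (ler_wpM2r _ (q_le j)) _ => //.
by rewrite -mulrA ler_wpM2l ?(ltW hw0)// -natrM ler_nat leq_trunc_div.
Qed.

Definition tube N y : set X := pi @^-1` dball S N lam y.

Definition tube_codes fam m y :=
  [seq J <- codes fam p m m | `[< exists2 z, follows p g B J z & tube (m * K0) y z >]].

(** Double counting: points following one code have images [2 * eps]-close up to time [m * K0], so
    two tubes containing such points have centres within [2 * lam + 2 * eps <= eta]. Separation then
    forces the centres to coincide. *)
Lemma sum_tube_codes fam m (G : seq Y) : separated S (m * K0) eta G ->
  (\sum_(y <- G) size (tube_codes fam m y) <= size (codes fam p m m))%N.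
Proof.
move=> [uG sG].
under eq_bigr do rewrite size_filter -sum1_count.
rewrite (exchange_big_dep xpredT)//= -sum1_size big_seq [leqRHS]big_seq.
apply: leq_sum => J Jc; have [Jf mJ] := mem_codes Jc.
rewrite -big_filter sum1_size.
set G' := [seq y <- G | _].
have : uniq G' by rewrite filter_uniq.
have : {in G' &, forall y y', y = y'}.
  move=> y y'; rewrite !mem_filter => /andP[/asboolP[z Jz yz] yG] /andP[/asboolP[z' Jz' yz'] yG'].
  apply: sG => //.
  apply: (@dclose_le _ _ _ (m * K0) _ (lam + (2 * eps + lam))) => //; first by move: sep; lra.
  apply: dclose_trans yz _; apply: dclose_trans (dclose_sym yz').
  exact: (follows_fiber Jf mJ Jz Jz').
case: G' => [|y [|y' G']] //= h; rewrite inE.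
by rewrite (h y y') ?inE ?eqxx ?orbT.
Qed.

Variable tau : Y -> nat.
Hypothesis tau_gt0 : forall y, (0 < tau y)%N.
Hypothesis tube_tau : forall y, (cover_nat T K0 e1 (tube K0 y) <= tau y)%N.

Definition log_tau y b : R := ln (tau (iter (b * K0) S y))%:R.

Lemma tile_scale fam N pm J : (forall j, j \in fam -> (N <= p j <= pm)%N) ->
  {subset J <= fam} ->
  forall t, t \in [seq (p j, q j) | j <- J] -> tile_at_scale w N pm t.
Proof.
move=> famP Jf _ /mapP[j /Jf jf ->]; split => //=; first exact: famP.
have /andP[_] := truncn_itv (mulr_ge0 (ltW hw0) (ler0n R (p j))).
rewrite -/(q j) -natr1; lra.
Qed.

(** For a fixed code a base block needs one set, since [2 * eps < e1]. On a free block the orbit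
    stays in the tube around the shifted centre, which costs [tau]. *)
Lemma cover_tube fam pm m y (c : R) :
  (forall j, j \in fam -> (0 < p j)%N /\ (p j <= pm)%N) ->
  (forall x, exists2 j, j \in fam & B j x) ->
  (forall J, {subset J <= fam} -> (code_length p J <= m + pm)%N ->
     free_sum (log_tau y) 0 [seq (p j, q j) | j <- J] <= c) ->
  (cover_nat T (m * K0) e1 (tube (m * K0) y))%:R <=
  (size (tube_codes fam m y))%:R * expR c.
Proof.
move=> famP famC free_le.
have := @cover_nat_bigU _ _ T cT cX (m * K0) e1 (tube (m * K0) y) _
  (tube_codes fam m y) (fun J => follows p g B J `&` tube (m * K0) y) e10.
move=> /(_ _)/wrap[x tx|].
  have [|J Jc Jx] := @codes_cover _ fam p X g B _ famC m m x (leqnn _).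
    by move=> j /famP[].
  by exists J => //; rewrite mem_filter Jc andbT; apply/asboolP; exists x.
rewrite -(ler_nat R) => /le_trans; apply; rewrite natr_sum.
apply: (@le_trans _ _ (\sum_(J <- tube_codes fam m y) expR c)); last first.
  by rewrite big_const_seq count_predT iter_addr_0 -[leLHS]mulr_natl.
rewrite big_seq [leRHS]big_seq; apply: ler_sum => J.
rewrite mem_filter => /andP[_ Jc]; have [Jf mJ] := mem_codes Jc.
have Jlen : (code_length p J <= m + pm)%N.
  by apply: code_length_le Jc => j /famP[].
set Om := _ `&` _.
pose Omb b : set X := [set iter (b * K0) T z | z in Om].
have OmP b x : (b < m)%N -> Om x -> Omb b (iter (b * K0) T x) by move=> _ Ox; exists x.
have := cover_nat_iter cT cX (L := m) (N := K0) e10 OmP.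
rewrite -(ler_nat R) => /le_trans; apply; rewrite natr_prod.
pose free b := if in_tile p (fun j b => b < q j)%N J b then 0 else log_tau y b.
have free0 b : 0 <= free b.
  by rewrite /free; case: ifP => // _; rewrite ln_ge0// ler1n tau_gt0.
apply: (@le_trans _ _ (\prod_(0 <= b < m) expR (free b))).
  rewrite big_nat [leRHS]big_nat; apply: ler_prod => b /andP[_ bm]; rewrite ler0n /= /free.
  case: ifP => [Jb|_].
    rewrite expR0 lern1; apply: cover_nat_dsmall.
    apply: (@dsmall_dclose _ _ _ _ (2 * eps)).
      by rewrite eps_e1 andbT mulr_ge0// ltW.
    move=> _ _ [z [Jz _] <-] [z' [Jz' _] <-]; exact: (follows_base Jf Jz Jz' Jb).
  rewrite /log_tau lnK ?posrE ?ltr0n// ler_nat.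
  apply: leq_trans (tube_tau (iter (b * K0) S y)).
  apply: le_cover_nat => // _ [z [_ tz] <-]; rewrite /tube /preimage /=.
  rewrite (factor_iter hpi); apply: dclose_iter tz.
  by rewrite addnC -mulSn leq_mul2r bm orbT.
rewrite -expR_sum ler_expR; apply: le_trans (free_le J Jf Jlen).
rewrite -(@free_sum_in_tile R _ p (fun j b => b < q j)%N q (log_tau y) 0 J)//.
exact: (le_psum free0 mJ).
Qed.

End TubeCounting.

(** * Growth of fibre weights over separated sets *)

Section TubeGrowth.
Context {R : realType} {X Y : metricType R}.
Variables (T : X -> X) (S : Y -> Y) (pi : X -> Y) (w : R).
Hypothesis hT : dynamical_system T.
Hypothesis hS : dynamical_system S.
Hypothesis hpi : factor_map T S pi.
Hypothesis hw : 0 < w <= 1.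

Let hw0 : 0 < w. Proof. by case/andP: hw. Qed.
Let hw1 : w <= 1. Proof. by case/andP: hw. Qed.
Let hw01 : 0 <= w <= 1. Proof. by case/andP: hw => /ltW-> ->. Qed.

Variables (K0 : nat) (eta lam e1 s H C : R) (tau : Y -> nat).
Hypothesis K00 : (0 < K0)%N.
Hypotheses (lam0 : 0 < lam) (lam_eta : 4 * lam <= eta) (e10 : 0 < e1).
Hypothesis s0 : 0 <= s.
Hypothesis hs : (htopFH T S pi w (1 - w) < s%:E)%E.
Hypothesis tau_gt0 : forall y, (0 < tau y)%N.
Hypothesis tau_le : forall y, ln (tau y)%:R <= C.
Hypothesis tube_tau : forall y, (cover_nat T K0 e1 (tube S pi lam K0 y) <= tau y)%N.
Hypothesis tau_sum : forall m G, separated S (m * K0) eta G ->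
  \sum_(y <- G) expR (w * psum (log_tau S K0 tau y) m) <= expR (H * m%:R).

Local Notation p := (@tile_blocks X K0).
Local Notation q := (@base_blocks R X w K0).

Let log_tau_bound y b : 0 <= log_tau S K0 tau y b <= C.
Proof. by rewrite /log_tau ln_ge0 ?ler1n//=. Qed.

(** The interpolation at one point. Both factors are normalised before Young's inequality, by [A]
    and by [H * m], the logarithms of the bounds for their sums over a separated set; each
    normalised sum will be at most 1. *)
Lemma stationary_tube_le (c : R) eps fam m y :
    (cover_nat T (m * K0) e1 (tube S pi lam (m * K0) y))%:R <=
    (size (tube_codes T S pi w K0 eps lam fam m y))%:R *
    expR ((1 - w) * psum (log_tau S K0 tau y) m + c) ->
  forall A : R, fiber_weight T pi w (m * K0) e1 (dball S (m * K0) lam y) <=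
    expR (w * A + (1 - w) * (H * m%:R) + w * c) *
    ((size (tube_codes T S pi w K0 eps lam fam m y))%:R * expR (- A) +
     expR (w * psum (log_tau S K0 tau y) m) * expR (- (H * m%:R))).
Proof.
move=> le_cov A; rewrite /fiber_weight -/(tube S pi lam (m * K0) y).
set t := cover_nat _ _ _ _ in le_cov *.
set n := (size _)%:R in le_cov *; set P := psum _ _ in le_cov *.
have n0 : 0 <= n by exact: ler0n.
apply: (@le_trans _ _ ((n * expR ((1 - w) * P + c)) `^ w)).
  by rewrite ge0_ler_powR ?nnegrE ?(ltW hw0)// mulr_ge0// expR_ge0.
rewrite powRM ?expR_ge0//.
have powE x r : expR x `^ r = expR (x * r) :> R by rewrite expRM.
rewrite powE.
have := @powR_mul_le_add R w (n * expR (- A)) (expR (w * P) * expR (- (H * m%:R))).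
rewrite !mulr_ge0 ?expR_ge0// => /(_ isT isT hw01).
rewrite powRM ?expR_ge0// powE -expRD powE => le_sum.
rewrite -(ler_pM2l (expR_gt0 (w * A + (1 - w) * (H * m%:R) + w * c))) in le_sum.
apply: le_trans le_sum; rewrite le_eqVlt; apply/orP; left; apply/eqP.
rewrite -mulrA -expRD [RHS]mulrCA -expRD; congr (_ * expR _); ring.
Qed.

Lemma tube_growth d : 0 < d -> exists m0, forall m, (m0 <= m)%N ->
  forall G, separated S (m * K0) eta G ->
  \sum_(y <- G) fiber_weight T pi w (m * K0) e1 (dball S (m * K0) lam y)
    <= expR ((w * s * K0%:R + (1 - w) * H + d) * m%:R).
Proof.
move=> d0.
(* The first entry gives [2 * eps < e1]; the second, with [4 * lam <= eta], gives
   [2 * lam + 2 * eps <= eta]. *)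
pose eps := Num.min (e1 / 3) (eta / 8).
have eta0 : 0 < eta by move: lam_eta lam0; lra.
have eps0 : 0 < eps by rewrite lt_min !divr_gt0.
have eps_e1 : 2 * eps < e1.
  have : eps <= e1 / 3 by rewrite ge_min lexx.
  by move: e10; lra.
have sep : 2 * lam + 2 * eps <= eta.
  have : eps <= eta / 8 by rewrite ge_min lexx orbT.
  by move: lam_eta eta0; lra.
(* Four parts pay for stationarity, one for the rate of the block family and one for the constants
   independent of [m]. *)
pose del := d / 6.
have del0 : 0 < del by rewrite divr_gt0.
have [[x0 _] _ _] := hT.
have C0 : 0 <= C by have /andP[] := log_tau_bound (pi x0) 0%N; exact: le_trans.
have /choice[fp fpP] : forall N, exists fp : seq (X * nat) * nat, [/\
    forall j, j \in fp.1 -> (0 < p j)%N /\ (N <= p j <= fp.2)%N,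
    forall x, exists2 j, j \in fp.1 & wball T S pi w (1 - w) j.2 j.1 eps x &
    \sum_(j <- fp.1) expR (- (s * K0%:R + del) * (p j)%:R) <= 1].
  by move=> N; exact: block_family.
pose Nf (A : nat) : nat := (Num.truncn ((2 * (A%:R * C) + C) / del)).+1.
pose Wf (n : nat) : nat := (Num.truncn (C * n%:R / del)).+1.
(* The lacunary scales: tiles at scale [k] are long compared with the sum of the earlier windows,
   and window [k] is long compared with these tiles. The recursion carries that sum. *)
pose sW := fix sW k : nat := if k is k'.+1 then (sW k' + Wf (fp (Nf (sW k'))).2)%N else 0%N.
pose Ns k := Nf (sW k).
pose pms k := (fp (Ns k)).2.
pose Ws k := Wf (pms k).
have sWE k : (\sum_(0 <= i < k) Ws i)%N = sW k.
  by elim: k => [|k IHk]; [rewrite big_geq|rewrite big_nat_recr//= IHk].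
have [K K_gt0 CK] : exists2 K : nat, (0 < K)%N & C ^+ 2 <= K%:R * del ^+ 2.
  exists (Num.truncn (C ^+ 2 / del ^+ 2)).+1 => //.
  by rewrite -ler_pdivrMr ?exprn_gt0// ltW// truncnS_gt.
have [|||D DP] := @exists_stationary_scale R Ws Ns pms C w K del _ C0 hw01 del0 K_gt0 CK.
- by [].
- by move=> k; rewrite sWE [leRHS]mulrC -ler_pdivrMr// ltW// truncnS_gt.
- by move=> k; rewrite [leRHS]mulrC -ler_pdivrMr// ltW// truncnS_gt.
pose s' := s * K0%:R + del.
have s'0 : 0 <= s' by rewrite addr_ge0 ?mulr_ge0// ltW.
pose D' := 1 + `|D|.
have D'0 : 0 < D' by rewrite ltr_wpDr.
pose pmax := (\sum_(k < K) pms k)%N.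
pose cst := D' + s' * pmax%:R.
pose m0 := (Num.truncn ((ln (2 * K%:R) + cst) / del)).+1.
exists m0 => m m0m G Gsep.
pose A k := s' * (m + pms k)%:R.
pose fam k := (fp (Ns k)).1.
pose nt k y : R := (size (tube_codes T S pi w K0 eps lam (fam k) m y))%:R.
pose c := 4 * del * m%:R + D'.
pose U k y := expR (w * A k + (1 - w) * (H * m%:R) + w * c) *
    (nt k y * expR (- A k) + expR (w * psum (log_tau S K0 tau y) m) * expR (- (H * m%:R))).
have U0 k y : 0 <= U k y.
  by rewrite mulr_ge0 ?expR_ge0// addr_ge0// mulr_ge0 ?expR_ge0// ler0n.
(* The stationary scale depends on [y]; adding the bounds of all [K] scales removes this dependence
   before summing over [G]. *)
have tU y : fiber_weight T pi w (m * K0) e1 (dball S (m * K0) lam y) <=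
    \sum_(k < K) U k y.
  have [k kK kP] := DP (log_tau S K0 tau y) m (log_tau_bound y).
  apply: (@le_trans _ _ (U k y)); last first.
    by rewrite (bigD1 (Ordinal kK))//= lerDl sumr_ge0.
  have [famP famC _] := fpP (Ns k).
  apply: stationary_tube_le => //.
  apply: (cover_tube hT hpi hw (pm := pms k) eps0 eps_e1 tau_gt0 tube_tau) => //.
    by move=> j /famP[? /andP[_ ?]].
  move=> J Jf Jlen.
  have len : tiling_length [seq (p j, q j) | j <- J] = code_length p J.
    by rewrite /tiling_length big_map.
  apply: le_trans (kP _ _ _) _; last first.
  - rewrite -addrA lerD2l lerD2l /D'; have := ler_norm D; lra.
  - by rewrite len.
  - by apply: (tile_scale hw _ Jf) => j /famP[].
apply: (@le_trans _ _ (\sum_(y <- G) \sum_(k < K) U k y)); first exact: ler_sum.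
rewrite exchange_big /=.
have Usum k : (k < K)%N -> \sum_(y <- G) U k y <= expR (w * A k + (1 - w) * (H * m%:R) + w * c) * 2.
  move=> kK; rewrite -mulr_sumr ler_wpM2l ?expR_ge0// big_split /= -!mulr_suml.
  have [famP famC fam1] := fpP (Ns k).
  have h1 : \sum_(y <- G) nt k y <= expR (A k).
    rewrite -natr_sum; apply: (@le_trans _ _ (size (codes (fam k) p m m))%:R).
      by rewrite ler_nat; exact: (sum_tube_codes w hpi K00 sep (fam k) Gsep).
    apply: size_codes_le => //.
    by move=> j /famP[_ /andP[_]].
  have h2 := tau_sum Gsep.
  have E x y : x <= expR y -> x * expR (- y) <= 1 :> R.
    by move=> xy; rewrite expRN ler_pdivrMr ?expR_gt0// mul1r.
  by have := E _ _ h1; have := E _ _ h2; lra.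
apply: (@le_trans _ _ (\sum_(k < K) expR ((w * s * K0%:R + (1 - w) * H + 5 * del) * m%:R + cst) * 2)).
  apply: ler_sum => k _; apply: le_trans (Usum k (ltn_ord k)) _.
  rewrite ler_wpM2r// ler_expR /A /c /cst.
  have h1 : w * (s' * (pms k)%:R) <= s' * pmax%:R.
    apply: (@le_trans _ _ (s' * (pms k)%:R)).
      by rewrite ler_piMl// mulr_ge0.
    by rewrite ler_wpM2l// ler_nat /pmax (bigD1 k)//= leq_addr.
  have h2 : w * D' <= D' by rewrite ler_piMl// ltW.
  have h3 : w * (del * m%:R) <= del * m%:R by rewrite ler_piMl// mulr_ge0// ltW.
  move: h1 h2 h3; rewrite /s' natrD; lra.
rewrite sumr_const card_ord -[leLHS]mulr_natl.
have K2 : 0 < 2 * K%:R :> R by rewrite mulr_gt0// ltr0n.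
rewrite mulrA mulrAC [K%:R * 2]mulrC -{1}[2 * K%:R]lnK ?posrE// -expRD ler_expR.
have : ln (2 * K%:R) + cst <= del * m%:R.
  rewrite [leRHS]mulrC -ler_pdivrMr//; apply: ltW; apply: (lt_le_trans (truncnS_gt _)).
  by rewrite ler_nat.
have : d = 6 * del by rewrite /del; field.
by move=> ->; lra.
Qed.

End TubeGrowth.

(** An [eta]-small set contains at most one point of a separated set, so sizes are bounded by the
    cover number; a largest one is [eta]-dense in [P]. *)
Lemma exists_max_separated (R : realType) (Y : metricType R) (S : Y -> Y) N (eta : R)
    (P : set Y) : dynamical_system S -> 0 < eta ->
  exists G, [/\ separated S N eta G, forall y, y \in G -> P y &
    forall y, P y -> exists2 y', y' \in G & dclose S N eta y' y].
Proof.
move=> [_ cY cS] eta0.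
pose Q n := `[< exists G, [/\ separated S N eta G, forall y, y \in G -> P y & size G = n] >].
have exQ : exists n, Q n by exists 0%N; apply/asboolP; exists [::]; split.
have ubQ n : Q n -> (n <= cover_nat S N eta setT)%N.
  move=> /asboolP[G [[uG sG] _ <-]].
  have [A As YA] := cover_nat_covered cS cY N setT eta0.
  have /choice[k kP] : forall y, exists k, (k < cover_nat S N eta setT)%N /\ A k y.
    by move=> y; have [k kn Ak] := YA y Logic.I; exists k.
  rewrite -(size_map k) -[X in (_ <= X)%N](size_iota 0); apply: uniq_leq_size.
    rewrite map_inj_in_uniq// => y y' yG yG' kk; apply: sG => //.
    by apply: (dsmall_close (As (k y))); [case: (kP y)|rewrite kk; case: (kP y')].
  by move=> _ /mapP[y _ ->]; rewrite mem_iota; case: (kP y).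
case: (ex_maxnP exQ ubQ) => n /asboolP[G [[uG sG] GP Gn]] maxn.
exists G; split => // y Py; apply: contrapT => far.
have far' y' : y' \in G -> ~ dclose S N eta y' y by move=> yG yy; apply: far; exists y'.
have yG : y \notin G by apply/negP => /far'; apply; exact: dclose_refl.
suff /maxn : Q n.+1 by rewrite ltnn.
apply/asboolP; exists (y :: G); split; last by rewrite /= Gn.
- split; first by rewrite /= yG.
  move=> u v; rewrite !inE => /orP[/eqP->|uG'] /orP[/eqP->|vG] //.
  + by move=> /dclose_sym /(far' _ vG).
  + by move=> /(far' _ uG').
  + exact: sG.
- by move=> u; rewrite inE => /orP[/eqP->|/GP].
Qed.

(** * Pigeonhole over radii and comparison of the entropies *)

Section LowerBound.
Context {R : realType} {X Y : metricType R}.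
Variables (T : X -> X) (S : Y -> Y) (pi : X -> Y) (w : R).
Hypothesis hT : dynamical_system T.
Hypothesis hS : dynamical_system S.
Hypothesis hpi : factor_map T S pi.
Hypothesis hw : 0 < w <= 1.

Let hw0 : 0 < w. Proof. by case/andP: hw. Qed.
Let hw1 : w <= 1. Proof. by case/andP: hw. Qed.
Let cX := ds_compact hT.
Let cT := ds_continuous hT.
Let cY := ds_compact hS.
Let cS := ds_continuous hS.

Variables (s h : R).
Hypothesis s0 : 0 <= s.
Hypothesis hs : (htopFH T S pi w (1 - w) < s%:E)%E.
Hypothesis hE : htopw T S pi w = h%:E.

Lemma tube_growth_level e1 eta d : 0 < eta -> eta <= e1 -> 0 < d ->
  exists (K0 : nat) (lam : R) (m0 : nat),
  [/\ (0 < K0)%N, 0 < lam, 4 * lam <= eta &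
    forall m G, (m0 <= m)%N -> separated S (m * K0) eta G ->
    \sum_(y <- G) fiber_weight T pi w (m * K0) e1 (dball S (m * K0) lam y)
      <= expR ((w * s + (1 - w) * (h + d) + d) * (m * K0)%:R)].
Proof.
move=> eta0 etae d0.
have e10 : 0 < e1 by exact: lt_le_trans etae.
have [h' [h'E h'0 _ hlt]] := htopw_epsP hT hS hpi hw0 eta0.
have h'h : h' <= h.
  by rewrite -lee_fin -hE -h'E; apply: le_lim_at_right0 (le_htopw_eps hT hS hpi hw0) _ eta0.
have [K0 K00 Kw] := hlt d d0.
have [n [V [[oV covV sV] Vw]]] := wcover_lt hT hS hpi hw0 eta0 Kw.
(* The Lebesgue number attaches to each point one member of the cover containing its whole ball of
   radius [lam0]; this is the origin of [lam] and [tau]. *)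
have [lam0 lam00 lebV] := lebesgue_number cY oV covV.
have /choice[kappa kappaP] := lebV.
pose lam := Num.min lam0 (eta / 4).
pose tau y := cover_nat T K0 e1 (pi @^-1` V (kappa y)).
have tau_gt0 y : (0 < tau y)%N.
  apply: cover_nat_gt0 => //; have [x xy] := factor_surj hpi y; exists x.
  by rewrite /preimage /= xy; apply: kappaP; rewrite mdistxx.
have tube_tau y : (cover_nat T K0 e1 (tube S pi lam K0 y) <= tau y)%N.
  apply: le_cover_nat => // x tx; rewrite /preimage /=; apply: kappaP.
  by apply: lt_le_trans (tx 0%N K00) _; rewrite ge_min lexx.
have tau_le y : ln (tau y)%:R <= ln (cover_nat T K0 e1 setT)%:R :> R.
  by rewrite ler_ln ?posrE ?ltr0n ?ler_nat ?le_cover_nat// (leq_trans (tau_gt0 y))// le_cover_nat.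
have tau_sum m G : separated S (m * K0) eta G ->
  \sum_(y <- G) expR (w * psum (log_tau S K0 tau y) m) <= expR ((h + d) * K0%:R * m%:R).
  move=> [uG sG].
  pose u y : {ffun 'I_m -> 'I_n} := [ffun b : 'I_m => kappa (iter (b * K0) S y)].
  pose F (v : {ffun 'I_m -> 'I_n}) := \prod_(b < m) fiber_weight T pi w K0 eta (V (v b)).
  apply: (@le_trans _ _ (\sum_(y <- G) F (u y))).
    apply: ler_sum => y _; rewrite /psum mulr_sumr expR_sum big_mkord.
    apply: ler_prod => b _; rewrite expR_ge0 /= ffunE /log_tau.
    set z := iter _ _ _.
    have -> : expR (w * ln (tau z)%:R) = fiber_weight T pi w K0 e1 (V (kappa z)).
      by rewrite /fiber_weight /powR pnatr_eq0 gtn_eqF//; exact: tau_gt0.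
    rewrite ge0_ler_powR ?nnegrE ?(ltW hw0)//.
    by rewrite ler_nat le_cover_nat.
  rewrite -(big_map u xpredT F).
  (* Members of the cover are [eta]-small up to time [K0], so points with equal words are
     [eta]-close up to time [m * K0]. Distinct points of [G] thus occupy distinct terms of the
     expanded power. *)
  have uu : uniq (map u G).
    rewrite map_inj_in_uniq// => y y' yG yG' uy; apply: sG => // t tmK.
    have tK : (t %/ K0 < m)%N by rewrite ltn_divLR.
    have rK : (t %% K0 < K0)%N by rewrite ltn_mod.
    have Vy z : V (u z (Ordinal tK)) (iter (t %/ K0 * K0) S z).
      by rewrite ffunE /=; apply: kappaP; rewrite mdistxx.
    rewrite (divn_eq t K0) addnC !iterD.
    by apply: (dsmall_close (sV (u y (Ordinal tK)))) => //; rewrite uy.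
  rewrite big_uniq//=; apply: (@le_trans _ _ (\sum_v F v)).
    rewrite [leRHS](bigID (fun v => v \in map u G)) /= lerDl sumr_ge0// => v _.
    by rewrite prodr_ge0// => b _; exact: fiber_weight_ge0.
  have -> : \sum_v F v = (\sum_k fiber_weight T pi w K0 eta (V k)) ^+ m.
    by rewrite -[m in RHS]card_ord -prodr_const bigA_distr_bigA.
  rewrite expRM_natr lerXn2r ?nnegrE ?expR_ge0//.
    by rewrite sumr_ge0// => k _; exact: fiber_weight_ge0.
  apply: le_trans (ltW Vw) _; rewrite ler_expR ler_wpM2r// lerD2r//.
have lam_pos : 0 < lam by rewrite lt_min lam00 divr_gt0.
have lam4 : 4 * lam <= eta.
  have : lam <= eta / 4 by rewrite ge_min lexx orbT.
  lra.
have [m0 m0P] := tube_growth hT hS hpi hw K00 lam_pos lam4 e10 s0 hs tau_gt0 tau_le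
  tube_tau tau_sum d0.
exists K0, lam, m0; split => // m G mm sG; apply: le_trans (m0P m mm G sG) _.
rewrite ler_expR natrM.
have dK : d * 1 <= d * K0%:R by rewrite ler_wpM2l ?(ltW d0)// ler1n.
have := ler_wpM2r (ler0n R m) dK; lra.
Qed.

Lemma cover_nat_le_expR e1 : 0 < e1 ->
  exists2 C : R, 0 <= C & forall M, (cover_nat T M e1 setT)%:R <= expR (C * M%:R).
Proof.
move=> e10; have [X0 _ _] := hT.
have c0 : (0 < cover_nat T 1 e1 setT)%N by exact: cover_nat_gt0.
exists (ln (cover_nat T 1 e1 setT)%:R); first by rewrite ln_ge0// ler1n.
move=> M; have := cover_nat_iter cT cX (L := M) (N := 1) (Om := setT)
  (Omb := fun=> setT) e10 (fun _ _ _ _ => Logic.I).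
rewrite muln1 -(ler_nat R) => /le_trans; apply.
by rewrite prod_nat_const_nat subn0 expRM_natr lnK ?posrE ?ltr0n// natrX.
Qed.

Lemma htopw_le_add d : 0 < d -> w * h <= w * s + 5 * d.
Proof.
move=> d0.
have [e1 e10 [h1 h1d wge]] : exists2 e1 : R, 0 < e1 & exists2 h1, h - d < h1 &
    forall N, (0 < N)%N -> expR (h1 * N%:R) <= wcover T S pi w N e1.
  apply: contrapT => no.
  have : (htopw T S pi w <= (h - d)%:E)%E.
    apply: lim_at_right0_le => [e e'|e e0]; first exact: le_htopw_eps.
    have [h1 [-> _ hle _]] := htopw_epsP hT hS hpi hw0 e0.
    by rewrite lee_fin leNgt; apply/negP => hd; apply: no; exists e => //; exists h1.
  by rewrite hE lee_fin; move: d0; lra.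
have [C1 C10 covC] := cover_nat_le_expR e10.
(* With [r] radii, a growth factor above [expR (d * M)] at every shrinking would exceed the cover
   number of the whole space. *)
have [r r0 rC] : exists2 r, (0 < r)%N & C1 < r%:R * d.
  exists (Num.truncn (C1 / d)).+1 => //.
  by rewrite -ltr_pdivrMr// truncnS_gt.
have /choice[L LP] : forall eta : R, exists L : nat * R * nat, 0 < eta <= e1 ->
  [/\ (0 < L.1.1)%N, 0 < L.1.2, 4 * L.1.2 <= eta &
    forall m G, (L.2 <= m)%N -> separated S (m * L.1.1) eta G ->
    \sum_(y <- G) fiber_weight T pi w (m * L.1.1) e1 (dball S (m * L.1.1) L.1.2 y)
      <= expR ((w * s + (1 - w) * (h + d) + d) * (m * L.1.1)%:R)].
  move=> eta; have [/andP[eta0 etae]|no] := boolP (0 < eta <= e1); last by exists (0%N, 0, 0%N).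
  have [K0 [lam [m0 P]]] := tube_growth_level eta0 etae d0.
  by exists (K0, lam, m0).
(* The next radius is the tube radius for which [tube_growth_level] controls sets separated at the
   current one. *)
pose eta := fix eta i : R := if i is i'.+1 then (L (eta i')).1.2 else e1 / 4.
have etaP i : 0 < eta i <= e1 / 4.
  elim: i => [|i IHi] /=; first by rewrite lexx divr_gt0.
  have /andP[i0 ie] := IHi.
  have [_ l0 l4 _] : [/\ _, _, _ & _] := LP (eta i) ltac:(apply/andP; split; lra).
  by apply/andP; split => //; lra.
have eta_e1 i : 0 < eta i <= e1 by have /andP[? ?] := etaP i; apply/andP; split; lra.
pose K i := (L (eta i)).1.1.
have K0 i : (0 < K i)%N by have [] := LP _ (eta_e1 i).
(* A common multiple of the block lengths, so that one time [M] serves all radii. *)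
pose N := (\prod_(i < r) K i)%N.
have N0 : (0 < N)%N by rewrite prodn_gt0.
pose l := (maxn (\max_(i < r) (L (eta i)).2) (Num.truncn (ln r%:R / d)).+1)%N.
pose M := (l * N)%N.
have M0 : (0 < M)%N by rewrite muln_gt0 N0 andbT leq_max orbT.
have MK i : (i < r)%N -> exists2 m, M = (m * K i)%N & ((L (eta i)).2 <= m)%N.
  move=> ir; exists (l * \prod_(j < r | j != Ordinal ir) K j)%N.
    by rewrite /M /N (bigD1 (Ordinal ir))//= -mulnA [(K i * _)%N]mulnC.
  apply: (@leq_trans l).
    rewrite leq_max; apply/orP; left.
    exact: (@leq_bigmax _ (fun i : 'I_r => (L (eta i)).2) (Ordinal ir)).
  by rewrite leq_pmulr// prodn_gt0.
pose t i y := cover_nat T M e1 (pi @^-1` dball S M (eta i) y).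
have t0 i y : (0 < t i y)%N.
  apply: cover_nat_gt0 => //; have [x xy] := factor_surj hpi y; exists x.
  rewrite /preimage /= xy; apply: dclose_refl.
  by have /andP[] := etaP i.
have step y : exists i, (i < r)%N /\ (t i y)%:R <= expR (d * M%:R) * (t i.+1 y)%:R :> R.
  apply: contrapT => no.
  have grow i : (i < r.+1)%N -> expR (i%:R * (d * M%:R)) * (t i y)%:R <= (t 0%N y)%:R.
    elim: i => [|i IHi] ir; first by rewrite mul0r expR0 mul1r.
    apply: le_trans (IHi (ltnW ir)).
    rewrite -natr1 mulrDl mul1r expRD -mulrA ler_wpM2l ?expR_ge0//.
    by rewrite leNgt; apply/negP => lt; apply: no; exists i; rewrite ltnS in ir; split => //; exact: ltW.
  have : (t 0%N y)%:R <= expR (C1 * M%:R).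
    by apply: le_trans (covC M); rewrite ler_nat; exact: le_cover_nat.
  move=> /(le_trans (grow r (leqnn _))) h1'.
  have : expR (r%:R * (d * M%:R)) <= expR (C1 * M%:R).
    by apply: le_trans h1'; rewrite ler_peMr ?expR_ge0// ler1n.
  rewrite ler_expR mulrA ler_pM2r ?ltr0n// leNgt => /negP; exact.
have /choice[lev levP] := step.
have /choice[G GP] : forall i, exists G, [/\ separated S M (eta i) G,
    forall y, y \in G -> lev y = i &
    forall y, lev y = i -> exists2 y', y' \in G & dclose S M (eta i) y' y].
  move=> i; have /andP[i0 _] := etaP i.
  exact: (@exists_max_separated R Y S M (eta i) [set y | lev y = i] hS i0).
(* Balls of radius [eta i] around a maximal separated set of the points of level [i] cover that
   level. At their centres, shrinking to [eta i.+1] costs at most [expR (d * M)], and the smaller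
   tubes are controlled. *)
pose I := [seq (i, y) | i <- iota 0 r, y <- G i].
pose V (k : 'I_(size I)) := dball S M (eta (tnth (in_tuple I) k).1) (tnth (in_tuple I) k).2.
have Vc : small_cover S M e1 V.
  split=> [k|y|k].
  - exact: open_dball.
  - have [ir _] := levP y; have [_ _ /(_ y erefl)[y' yG yy]] := GP (lev y).
    have yI : (lev y, y') \in I.
      by apply/allpairsPdep; exists (lev y), y'; split; rewrite // mem_iota add0n.
    have kI : (index (lev y, y') I < size I)%N by rewrite index_mem.
    exists (Ordinal kI).
    by rewrite /V (tnth_nth (lev y, y')) /= nth_index.
  - have /andP[i0 ie] := etaP (tnth (in_tuple I) k).1.
    by apply: dsmall_ball; [exact: ltW|lra].
have := wcover_le hT hS hpi hw0 e10 Vc.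
rewrite -(big_tnth _ _ I xpredT (fun q => fiber_weight T pi w M e1 (dball S M (eta q.1) q.2))).
rewrite big_allpairs_dep /=.
pose Q := w * s + (1 - w) * (h + d) + d.
have stage i : (i < r)%N -> \sum_(y <- G i) fiber_weight T pi w M e1 (dball S M (eta i) y)
    <= expR (d * M%:R + Q * M%:R).
  move=> ir; have [sG GL _] := GP i.
  have [m Mm m0m] := MK i ir.
  have [_ _ _ /(_ m (G i) m0m)] := LP _ (eta_e1 i).
  rewrite -/(K i) -Mm => /(_ sG) bnd.
  rewrite expRD; apply: (@le_trans _ _ (expR (d * M%:R) *
     \sum_(y <- G i) fiber_weight T pi w M e1 (dball S M (eta i.+1) y))); last first.
    by rewrite ler_wpM2l ?expR_ge0.
  rewrite mulr_sumr big_seq [leRHS]big_seq; apply: ler_sum => y yG.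
  have [_] := levP y; rewrite (GL y yG) => ty.
  apply: (@le_trans _ _ ((expR (d * M%:R) * (t i.+1 y)%:R) `^ w)).
    by rewrite /fiber_weight ge0_ler_powR ?nnegrE ?(ltW hw0)// mulr_ge0// expR_ge0.
  rewrite powRM ?expR_ge0// ler_wpM2r ?powR_ge0//.
  rewrite -[leRHS]powRr1 ?expR_ge0// ler_powR// -expR0 ler_expR.
  by rewrite mulr_ge0// ltW.
move=> wle.
have {wle} : wcover T S pi w M e1 <= r%:R * expR (d * M%:R + Q * M%:R).
  apply: le_trans wle _.
  apply: (@le_trans _ _ (\sum_(i <- iota 0 r) expR (d * M%:R + Q * M%:R))).
    rewrite big_seq [leRHS]big_seq; apply: ler_sum => i; rewrite mem_iota add0n => ir.
    exact: stage.
  by rewrite big_const_seq count_predT iter_addr_0 size_iota -[leLHS]mulr_natl.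
move=> /(le_trans (wge M M0)).
have rR : 0 < r%:R :> R by rewrite ltr0n.
rewrite -{1}[r%:R]lnK ?posrE// -expRD ler_expR => le1.
have MR : 0 < M%:R :> R by rewrite ltr0n.
have lnr : ln r%:R <= d * M%:R.
  rewrite [leRHS]mulrC -ler_pdivrMr//; apply: ltW; apply: (lt_le_trans (truncnS_gt _)).
  rewrite ler_nat /M; apply: (@leq_trans l); first by rewrite leq_max leqnn orbT.
  by rewrite leq_pmulr.
have : h1 * M%:R <= (2 * d + Q) * M%:R by move: le1 lnr; lra.
(* With [h - d < h1] this gives [w h < w s + 5 d - w d], whence the constant 5. *)
rewrite ler_pM2r// /Q.
have : 0 <= w * d by rewrite mulr_ge0 ?ltW.
move: h1d; lra.
Qed.

Lemma htopw_real_le : h <= s.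
Proof.
rewrite -(ler_pM2l hw0); apply/ler_addgt0Pr => e e0.
have := @htopw_le_add (e / 5); rewrite divr_gt0// => /(_ isT); lra.
Qed.

End LowerBound.

Lemma htopw_le_htopFH (R : realType) (X Y : metricType R)
    (T : X -> X) (S : Y -> Y) (pi : X -> Y) (w : R) :
  dynamical_system T -> dynamical_system S -> factor_map T S pi -> 0 < w <= 1 ->
  (htopw T S pi w <= htopFH T S pi w (1 - w))%E.
Proof.
move=> hT hS hpi hw; have /andP[hw0 hw1] := hw.
have FH0 : (0 <= htopFH T S pi w (1 - w))%E.
  apply: (@le_trans _ _ (htopFH_eps T S pi w (1 - w) 1)); first exact: htopFH_eps_ge0.
  by apply: le_lim_at_right0 => // e e' _; exact: le_htopFH_eps.
have w0 : (0 <= htopw T S pi w)%E.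
  apply: (@le_trans _ _ (htopw_eps T S pi w 1)).
    by have [h [-> h0 _ _]] := htopw_epsP hT hS hpi hw0 ltr01; rewrite lee_fin.
  by apply: le_lim_at_right0 => // e e'; exact: le_htopw_eps.
case E : (htopFH T S pi w (1 - w)) FH0 => [r||]; rewrite ?leey//.
rewrite lee_fin => r0; apply/lee_addgt0Pr => e e0; rewrite -EFinD.
have s0 : 0 <= r + e by rewrite addr_ge0// ltW.
have hs : (htopFH T S pi w (1 - w) < (r + e)%:E)%E by rewrite E lte_fin ltrDl.
have := htopw_lty hT hS hpi hw s0 hs.
case F : (htopw T S pi w) w0 => [h||] // _ _.
by rewrite lee_fin; exact: (htopw_real_le hT hS hpi hw s0 hs F).
Qed.

Theorem corollary1p4 (R : realType) (X Y : metricType R)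
    (T : X -> X) (S : Y -> Y) (pi : X -> Y) (w : R)
    (hT : dynamical_system T) (hS : dynamical_system S)
    (hpi : factor_map T S pi) (hw0 : 0 < w) (hw1 : w <= 1) :
  htopFH T S pi w (1 - w) = htopw T S pi w.
Proof.
have hw : 0 < w <= 1 by rewrite hw0.
apply/eqP; rewrite eq_le; apply/andP; split.
  exact: htopFH_le_htopw.
exact: htopw_le_htopFH.
Qed.
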